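(* Suppose $\xi_y$, $y\in\mathbb{N}^2$, are i.i.d. and distributed as $\mathrm{Geom}(\lambda)$, $\lambda\in(0,1)$, and let $\beta>0$ be fixed. Then almost surely $$\lim_{N\to\infty}\frac1N\,G(N,\lfloor\beta N\rfloor)=\frac{(1+\sqrt{\beta\lambda})^2}{1-\lambda}-1.$$ For each $\delta>0$ there exists $c=c(\delta)>0$ such that $$P\left\{\left|\frac1N\,G(N,\lfloor\beta N\rfloor)-\left(\frac{(1+\sqrt{\beta\lambda})^2}{1-\lambda}-1\right)\right|>\delta\right\}\le e^{-cN}$$ for all $N\in\mathbb{N}$.
   Context: $\mathbb{N}=\{1,2,\dots\}$. $\mathrm{Geom}(\lambda)$ is the distribution on $\{0,1,2,\dots\}$ with $P(\xi=k)=(1-\lambda)\lambda^k$. For $N,M\in\mathbb{N}$, the last passage percolation value $G(N,M)$ on $\{1,\dots,N\}\times\{1,\dots,M\}$ is the maximum of $\sum_{j=1}^{N+M-1}\xi_{y_j}$ over all oriented paths $(y_1,\dots,y_{N+M-1})$ from $(1,1)$ to $(N,M)$, i.e. $y_{j+1}-y_j\in\{(1,0),(0,1)\}$.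
   Formalization: The exponential bound is proved for all N ≥ N0(δ), not for all N: as stated it fails (β=1, λ=4/25, N=1, δ=1/4: the limit is 4/3, G(1,1) is an integer, so the probability is 1), and G(N,0) is undefined when ⌊βN⌋=0. *)

(* Defs.v *)
From HB Require Import structures.
From mathcomp Require Import all_boot all_order all_algebra.
From mathcomp Require Import all_classical all_reals all_analysis.

Set Implicit Arguments.
Unset Strict Implicit.
Unset Printing Implicit Defensive.

Import Order.TTheory GRing.Theory Num.Theory.
Import numFieldNormedType.Exports.

Local Open Scope classical_set_scope.
Local Open Scope ring_scope.

(* Lattice sites are pairs of naturals; the quadrant of the percolation model
   is {1, 2, ...}^2, so sites with a zero coordinate are never used. *)
Definition quadrant : set (nat * nat) :=
  [set y | (0 < y.1)%N /\ (0 < y.2)%N].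

Definition mutually_independent (R : realType) (d d' : measure_display)
    (T : measurableType d) (T' : measurableType d') (P : probability T R)
    (I : choiceType) (D : set I) (X : I -> {RV P >-> T'}) : Prop :=
  forall (s : seq I) (B : I -> set T'),
    uniq s -> [set` s] `<=` D -> (forall i, i \in s -> measurable (B i)) ->
    P (\bigcap_(i in [set` s]) (X i @^-1` B i)) =
    (\prod_(i <- s) P (X i @^-1` B i))%E.
Arguments mutually_independent {R d d' T T'} P {I} D X.

Definition geometric_law (R : realType) (d : measure_display)
    (T : measurableType d) (P : probability T R) (lambda : R)
    (X : {RV P >-> nat}) : Prop :=
  forall k : nat, P (X @^-1` [set k]) = ((1 - lambda) * lambda ^+ k)%:E.
Arguments geometric_law {R d T} P lambda X.

Definition oriented_step (u v : nat * nat) : bool :=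
  (v == (u.1.+1, u.2)) || (v == (u.1, u.2.+1)).

Definition oriented_path (a b : nat * nat) (s : seq (nat * nat)) : bool :=
  if s is x :: s' then
    [&& x == a, path oriented_step x s' & last x s' == b]
  else false.

Definition site (N M : nat) (u : 'I_N.+1 * 'I_M.+1) : nat * nat :=
  (u.1 : nat, u.2 : nat).

(* An oriented path from (1, 1) to (N, M) has N + M - 1 sites and stays in
   {1, ..., N} x {1, ..., M}, so these tuples represent all of them.  When
   N = 0 or M = 0 there is no path and the value is 0. *)
Definition last_passage (w : nat * nat -> nat) (N M : nat) : nat :=
  (\max_(p : (N + M).-1.-tuple ('I_N.+1 * 'I_M.+1)
         | oriented_path (1, 1) (N, M) (map (@site N M) p))
     \sum_(j < (N + M).-1) w (site (tnth p j)))%N.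

(* Main.v *)
Require Import Defs.
From HB Require Import structures.
From mathcomp Require Import all_boot all_order all_algebra.
From mathcomp Require Import all_classical all_reals all_analysis.
From mathcomp Require Import ring lra zify.

Set Implicit Arguments.
Unset Strict Implicit.
Unset Printing Implicit Defensive.

Import Order.TTheory GRing.Theory Num.Theory.
Import numFieldNormedType.Exports.

Local Open Scope classical_set_scope.
Local Open Scope ring_scope.

(** The limit is identified through the stationary version of the model.  Add a
row of boundary weights Geom(p) below the quadrant and a column of boundary
weights Geom(q) on its left.  When the bulk parameter is p q, the increments of
the last passage value along a horizontal and a vertical edge meeting at a
site, together with the weight of that site, undergo the map [burke]: it is an
involution of triples of naturals that preserves the product of the three
geometric weights ([geo_mean_burke]).  Sweeping it over a rectangle shows that
the last passage value is the sum of the bottom weights and of variables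
distributed as the left weights ([lpp_burke], [expect_burke_all]).  Tilting the
bottom weights by u then yields, for boundary parameters p, q and bulk
parameter p q u,

  E u^(lpp N M) = mgf p u ^ N * mgf q u ^ M,   mgf p u = (1 - p) / (1 - p u)

([expect_boundary]).  By convexity mgf p u <= u^(gmean (p u)) with
gmean x = x / (1 - x), the mean of Geom(x), so that all the estimates have the
form of a power of u.

For u >= 1 the value with boundary dominates the value in the bulk
([expect_bulk_le]); the exponential Markov inequality gives the upper tail, with
rate constant the minimum over a b = lambda of gmean a + beta * gmean b, which
is attained at an explicit critical pair ([critical_parameters]) and equals
(1 + sqrt (beta lambda))^2 / (1 - lambda) - 1.

For the lower tail, the boundary parameters are chosen close to the critical
pair.  An optimal path in the model with boundary leaves the boundary at some
point and then travels in the bulk ([lpp_exit]).  The value with boundary is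
unlikely to be small (same identity with u < 1).  An exit at distance more than
e N from the corner is unlikely to produce a value close to the typical one:
after the exit the bulk is compared with a model whose parameter a' is slightly
larger than the critical one, and moving off the critical pair while paying
gmean a < gmean a' on the initial stretch strictly lowers the rate
([gmean_gap]).  Otherwise the exit is close to the corner, and the boundary
contributes little, so that a small value in the bulk is unlikely as well.
[lower_tail_pointwise] and [expect_lower_tail] make this a sum of exponential
moments, and [lower_tail_bound] fixes the constants.

Only finitely many weights are involved at a time, so the expectations are
iterated sums over the values of finitely many geometric weights ([expect]);
[config_event_law] identifies the probabilities of the theorem with such sums,
which is where independence is used.  Almost sure convergence follows from the
exponential bound by the Borel-Cantelli lemma ([ae_cvg_exp_tail]). *)

(** * Means with respect to the geometric law *)

(** The mass that Geom(q) gives to k. *)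
Definition geo_weight (R : realType) (q : R) (k : nat) : R := (1 - q) * q ^+ k.

(** The mean of a nonnegative extended real function under Geom(q). *)
Definition geo_mean (R : realType) (q : R) (f : nat -> \bar R) : \bar R :=
  (\sum_(k <oo) (geo_weight q k)%:E * f k)%E.

Lemma geo_weight_ge0 (R : realType) (q : R) k : 0 <= q < 1 -> 0 <= geo_weight q k.
Proof.
move=> /andP[q0 q1]; apply: mulr_ge0; last exact: exprn_ge0.
by rewrite subr_ge0 ltW.
Qed.

Lemma geo_mean_ge0 (R : realType) (q : R) f : 0 <= q < 1 ->
  (forall k, 0 <= f k)%E -> (0 <= geo_mean q f)%E.
Proof.
move=> hq f0; apply: nneseries_ge0 => k _ _.
by rewrite mule_ge0 ?lee_fin ?geo_weight_ge0.
Qed.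

Lemma eq_geo_mean (R : realType) (q : R) f g :
  f =1 g -> geo_mean q f = geo_mean q g.
Proof. by move=> /funext ->. Qed.

Lemma le_geo_mean (R : realType) (q : R) f g : 0 <= q < 1 ->
  (forall k, 0 <= f k)%E -> (forall k, f k <= g k)%E ->
  (geo_mean q f <= geo_mean q g)%E.
Proof.
move=> hq f0 fg; apply: lee_nneseries => k.
  by move=> _ _; rewrite mule_ge0 ?lee_fin ?geo_weight_ge0.
by move=> _; rewrite lee_wpmul2l ?lee_fin ?geo_weight_ge0.
Qed.

Lemma geo_meanD (R : realType) (q : R) f g : 0 <= q < 1 ->
  (forall k, 0 <= f k)%E -> (forall k, 0 <= g k)%E ->
  (geo_mean q (fun k => f k + g k) = geo_mean q f + geo_mean q g)%E.
Proof.
move=> hq f0 g0; rewrite /geo_mean -nneseriesD; last 2 first.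
- by move=> k _ _; rewrite mule_ge0 ?lee_fin ?geo_weight_ge0.
- by move=> k _ _; rewrite mule_ge0 ?lee_fin ?geo_weight_ge0.
by apply: eq_eseriesr => k _; rewrite ge0_muleDr.
Qed.

Lemma geo_meanZ (R : realType) (q c : R) f : 0 <= q < 1 ->
  (forall k, 0 <= f k)%E ->
  (geo_mean q (fun k => c%:E * f k) = c%:E * geo_mean q f)%E.
Proof.
move=> hq f0; rewrite /geo_mean -nneseriesZl; last first.
  by move=> k _; rewrite mule_ge0 ?lee_fin ?geo_weight_ge0.
by apply: eq_eseriesr => k _; rewrite muleCA.
Qed.

Lemma geo_mean_cst (R : realType) (q : R) (c : \bar R) : 0 <= q < 1 ->
  (0 <= c)%E -> geo_mean q (fun=> c) = c.
Proof.
move=> hq; have /andP[q0 q1] := hq.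
have h1 : (\sum_(k <oo) (geo_weight q k)%:E = 1)%E.
  apply: cvg_lim => //.
  have -> : (fun n => \sum_(0 <= k < n) (geo_weight q k)%:E)%E =
            EFin \o series (geometric (1 - q) q).
    by apply/funext => n /=; rewrite sumEFin.
  apply: cvg_EFin; first by near=> n.
  have := @cvg_geometric_series _ (1 - q) q.
  by rewrite divff ?subr_eq0 ?gt_eqF// ger0_norm// => /(_ q1).
case: c => [c| |] //= c0; rewrite /geo_mean.
- under eq_eseriesr do rewrite muleC.
  rewrite nneseriesZl ?h1 ?mule1// => k _.
  by rewrite lee_fin geo_weight_ge0.
- apply: (@nneseries_pinfty _ _ _ 0) => //.
    by move=> k _; rewrite mule_ge0 ?lee_fin ?geo_weight_ge0.
  by rewrite /geo_weight expr0 mulr1 gt0_muley// lte_fin subr_gt0.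
Unshelve. all: by end_near.
Qed.

(** Tilting by u^k turns Geom(q) into Geom(q u), up to the normalizing
factor. *)
Lemma geo_mean_tilt (R : realType) (q u : R) f : 0 <= q < 1 -> 0 <= q * u < 1 ->
  (forall k, 0 <= f k)%E ->
  (geo_mean q (fun k => (u ^+ k)%:E * f k) =
   ((1 - q) / (1 - q * u))%:E * geo_mean (q * u) f)%E.
Proof.
move=> hq /andP[qu0 qu1] f0; rewrite /geo_mean -nneseriesZl; last first.
  by move=> k _; rewrite mule_ge0 ?lee_fin ?geo_weight_ge0 ?qu0.
apply: eq_eseriesr => k _; rewrite !muleA -!EFinM /geo_weight exprMn.
congr (_%:E * _)%E; rewrite mulrA divfK ?mulrA//.
by rewrite subr_eq0 gt_eqF.
Qed.

(** Tonelli's theorem for two geometric weights. *)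
Lemma geo_mean_exchange (R : realType) (q q' : R) (f : nat -> nat -> \bar R) :
  0 <= q < 1 -> 0 <= q' < 1 -> (forall k l, 0 <= f k l)%E ->
  geo_mean q (fun k => geo_mean q' (f k)) =
  geo_mean q' (fun l => geo_mean q (f^~ l)).
Proof.
move=> hq hq' f0; rewrite /geo_mean.
transitivity (\sum_(k <oo) \sum_(l <oo)
    ((geo_weight q k)%:E * ((geo_weight q' l)%:E * f k l)))%E.
  apply: eq_eseriesr => k _; rewrite nneseriesZl// => l _.
  by rewrite mule_ge0 ?lee_fin ?geo_weight_ge0.
rewrite nneseries_interchange; last first.
  by move=> k l; rewrite !mule_ge0 ?lee_fin ?geo_weight_ge0.
apply: eq_eseriesr => l _; rewrite -nneseriesZl; last first.
  by move=> k _; rewrite mule_ge0 ?lee_fin ?geo_weight_ge0.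
by apply: eq_eseriesr => k _; rewrite muleCA.
Qed.

(** * The weight-preserving involution *)

(** The action of one site on a triple (i, j, w): i is the increment of the last
passage value along the edge below the site, j the increment along the edge on
its left and w the weight of the site.  The result consists of the increments
along the edges above and on the right, and of minn i j.  Subtraction is
truncated, so w + (i - j) is the positive part of the difference plus w. *)
Definition burke (x : nat * nat * nat) : nat * nat * nat :=
  (x.2 + (x.1.1 - x.1.2), x.2 + (x.1.2 - x.1.1), minn x.1.1 x.1.2)%N.

Lemma burkeK : involutive burke.
Proof. by case=> [[i j] w]; rewrite /burke /=; congr (_, _, _); lia. Qed.

(** Burke's property: i + w and j + w are the sums of the corresponding entry
and the last entry of the image, so the joint law Geom(a) x Geom(b) x Geom(ab)
is invariant. *)
Lemma geo_mean_burke (R : realType) (a b : R)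
    (f : nat * nat * nat -> \bar R) :
  0 <= a < 1 -> 0 <= b < 1 -> (forall x, 0 <= f x)%E ->
  geo_mean a (fun i => geo_mean b (fun j => geo_mean (a * b)
    (fun w => f (burke (i, j, w))))) =
  geo_mean a (fun i => geo_mean b (fun j => geo_mean (a * b)
    (fun w => f (i, j, w)))).
Proof.
move=> ha hb f0.
have hab : 0 <= a * b < 1.
  move: ha hb => /andP[? ?] /andP[? ?]; rewrite mulr_ge0//=.
  by rewrite mulr_ilt1.
have E (g : nat * nat * nat -> \bar R) : (forall x, 0 <= g x)%E ->
  geo_mean a (fun i => geo_mean b (fun j => geo_mean (a * b)
    (fun w => g (i, j, w)))) =
  (\esum_(x in [set: nat * nat * nat])
   (geo_weight a x.1.1 * geo_weight b x.1.2 * geo_weight (a * b) x.2)%:E * g x)%E.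
  move=> g0; rewrite /geo_mean.
  transitivity (\sum_(i <oo) \sum_(j <oo) \sum_(w <oo)
    (geo_weight a i * geo_weight b j * geo_weight (a * b) w)%:E * g (i, j, w))%E.
    apply: eq_eseriesr => i _; rewrite -nneseriesZl; last first.
      move=> j _; rewrite mule_ge0 ?lee_fin ?geo_weight_ge0//.
      by apply: geo_mean_ge0.
    apply: eq_eseriesr => j _; rewrite -nneseriesZl; last first.
      by move=> w _; rewrite mule_ge0 ?lee_fin ?geo_weight_ge0//.
    rewrite -nneseriesZl; last first.
      by move=> w _; rewrite !mule_ge0 ?lee_fin ?geo_weight_ge0//.
    by apply: eq_eseriesr => w _; rewrite !muleA -!EFinM.
  have pos i j w : (0 <= (geo_weight a i * geo_weight b j * geo_weight (a * b) w)%:E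
      * g (i, j, w))%E.
    apply: mule_ge0 => //; rewrite lee_fin.
    by apply: mulr_ge0; [apply: mulr_ge0|]; exact: geo_weight_ge0.
  transitivity (\esum_(i in [set: nat]) \esum_(j in [set: nat])
    \esum_(w in [set: nat])
     ((geo_weight a i * geo_weight b j * geo_weight (a * b) w)%:E * g (i, j, w)))%E.
    rewrite nneseries_esumT; last first.
      by move=> i; do 2 apply: nneseries_ge0 => ? _ _.
    apply: eq_esum => i _; rewrite nneseries_esumT; last first.
      by move=> j; apply: nneseries_ge0 => ? _ _.
    by apply: eq_esum => j _; rewrite nneseries_esumT.
  rewrite esum_esum; last first.
    by move=> i j _ _; apply: esum_ge0 => w _; exact: pos.
  rewrite esum_esum; last by move=> [i j] w _ _; exact: pos.
  rewrite [RHS](_ : _ = (\esum_(k in ([set: nat] `*`` (fun=> [set: nat]))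
      `*`` (fun=> [set: nat]))
      (geo_weight a k.1.1 * geo_weight b k.1.2 * geo_weight (a * b) k.2)%:E * g k)%E).
    by apply: eq_esum => -[[i j] w].
  by congr esum; apply/seteqP; split => // -[[i j] w].
etransitivity; first exact: (E (f \o burke) (fun x => f0 _)).
rewrite E//.
rewrite [RHS](reindex_esum [set: nat * nat * nat] _ burke); last first.
  split=> //; first by move=> x y _ _ /(can_inj burkeK).
  by move=> x _; exists (burke x) => //; rewrite burkeK.
apply: eq_esum => -[[i j] w] _; congr (_%:E * _)%E.
rewrite /geo_weight /burke /= !exprMn.
(* The exponents of a and b in the weight of the image triple. *)
have ei : (w + (i - j) + minn i j = i + w)%N by lia.
have ej : (w + (j - i) + minn i j = j + w)%N by lia.
transitivity ((1 - a) * (1 - b) * (1 - a * b) *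
  (a ^+ (i + w) * b ^+ (j + w))); first by rewrite !exprD; ring.
by rewrite -ei -ej !exprD; ring.
Qed.

(** * Iterated geometric expectations over finitely many sites *)

(** The configuration w with its value at y replaced by k. *)
Definition upd (I : eqType) (w : I -> nat) (y : I) (k : nat) : I -> nat :=
  fun z => if z == y then k else w z.

Lemma upd_same (I : eqType) (w : I -> nat) y k : upd w y k y = k.
Proof. by rewrite /upd eqxx. Qed.

Lemma upd_diff (I : eqType) (w : I -> nat) y z k :
  z != y -> upd w y k z = w z.
Proof. by rewrite /upd => /negPf ->. Qed.

Lemma updC (I : eqType) (w : I -> nat) y z k l : y != z ->
  upd (upd w y k) z l = upd (upd w z l) y k.
Proof.
move=> yz; apply/funext => x; rewrite /upd; case: eqVneq => // ->.
by rewrite eq_sym (negPf yz).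
Qed.

(** The expectation of F when the weights at the sites of s are independent,
the weight at y being Geom(q y), and the weights at all other sites are frozen
to their values in w. *)
Fixpoint expect (R : realType) (I : eqType) (s : seq I) (q : I -> R)
    (F : (I -> nat) -> \bar R) (w : I -> nat) : \bar R :=
  if s is y :: s' then geo_mean (q y) (fun k => expect s' q F (upd w y k))
  else F w.

Lemma expect_ge0 (R : realType) (I : eqType) (s : seq I) (q : I -> R) F w :
  (forall y, 0 <= q y < 1) -> (forall w, 0 <= F w)%E -> (0 <= expect s q F w)%E.
Proof.
move=> hq F0; elim: s w => [|y s IH] w //=; exact: geo_mean_ge0.
Qed.

(** F is averaged to itself as soon as it does not depend on the sites of s. *)
Lemma expect_cst (R : realType) (I : eqType) (s : seq I) (q : I -> R) F w :
  (forall y, 0 <= q y < 1) -> (forall w, 0 <= F w)%E ->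
  (forall w', (forall y, y \notin s -> w' y = w y) -> F w' = F w) ->
  expect s q F w = F w.
Proof.
move=> hq F0; elim: s w => [|y s IH] w Fw //=.
have Fk k : F (upd w y k) = F w.
  apply: Fw => z; rewrite inE negb_or => /andP[zy _]; exact: upd_diff.
rewrite -[RHS](@geo_mean_cst _ (q y))//; apply: eq_geo_mean => k.
rewrite IH ?Fk// => w' Hw'; apply: Fw => z; rewrite inE negb_or => /andP[zy zs].
by rewrite Hw'// upd_diff.
Qed.

(** Only configurations that agree with w off s matter. *)
Lemma le_expect (R : realType) (I : eqType) (s : seq I) (q : I -> R) F F' w :
  (forall y, 0 <= q y < 1) -> (forall w, 0 <= F w)%E ->
  (forall w', (forall y, y \notin s -> w' y = w y) -> F w' <= F' w')%E ->
  (expect s q F w <= expect s q F' w)%E.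
Proof.
move=> hq F0; elim: s w => [|y s IH] w Fw /=; first exact: Fw.
apply: le_geo_mean => // k; first exact: expect_ge0.
apply: IH => w' Hw'; apply: Fw => z; rewrite inE negb_or => /andP[zy zs].
by rewrite Hw'// upd_diff.
Qed.

(** Only configurations that agree with w off s, and the parameters on s,
matter. *)
Lemma eq_expect (R : realType) (I : eqType) (s : seq I) (q q' : I -> R) F F' w :
  (forall y, y \in s -> q y = q' y) ->
  (forall w', (forall y, y \notin s -> w' y = w y) -> F w' = F' w')%E ->
  expect s q F w = expect s q' F' w.
Proof.
elim: s w => [|y s IH] w qq Fw /=; first exact: Fw.
rewrite qq ?mem_head//; apply: eq_geo_mean => k.
apply: IH => [z zs|w' Hw']; first by rewrite qq// inE zs orbT.
apply: Fw => z; rewrite inE negb_or => /andP[zy zs].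
by rewrite Hw'// upd_diff.
Qed.

Lemma expectD (R : realType) (I : eqType) (s : seq I) (q : I -> R) F F' w :
  (forall y, 0 <= q y < 1) ->
  (forall w, 0 <= F w)%E -> (forall w, 0 <= F' w)%E ->
  (expect s q (fun w => F w + F' w) w = expect s q F w + expect s q F' w)%E.
Proof.
move=> hq F0 F'0; elim: s w => [|y s IH] w //=.
by rewrite -geo_meanD//; [apply: eq_geo_mean => k; exact: IH| |] => k;
  exact: expect_ge0.
Qed.

Lemma expectZ (R : realType) (I : eqType) (s : seq I) (q : I -> R) (c : R) F w :
  (forall y, 0 <= q y < 1) -> (forall w, 0 <= F w)%E ->
  (expect s q (fun w => c%:E * F w) w = c%:E * expect s q F w)%E.
Proof.
move=> hq F0; elim: s w => [|y s IH] w //=.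
by rewrite -geo_meanZ//; [apply: eq_geo_mean => k; exact: IH|] => k;
  exact: expect_ge0.
Qed.

Lemma expect_sum (R : realType) (I : eqType) (s : seq I) (q : I -> R)
    (J : Type) (r : seq J) (F : J -> (I -> nat) -> \bar R) w :
  (forall y, 0 <= q y < 1) -> (forall j w, 0 <= F j w)%E ->
  (expect s q (fun w => \sum_(j <- r) F j w) w = \sum_(j <- r) expect s q (F j) w)%E.
Proof.
move=> hq F0; elim: r => [|j r IH].
  rewrite big_nil -[RHS](_ : expect s q (fun=> 0) w = 0)%E; last exact: expect_cst.
  by apply: eq_expect => // w' _; rewrite big_nil.
rewrite big_cons -IH -expectD//; last by move=> w'; exact: sume_ge0.
by apply: eq_expect => // w' _; rewrite big_cons.
Qed.

Lemma expect_cat (R : realType) (I : eqType) (s s' : seq I) (q : I -> R) F w :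
  expect (s ++ s') q F w = expect s q (expect s' q F) w.
Proof. by elim: s w => [|y s IH] w //=; apply: eq_geo_mean => k. Qed.

(** The order of integration is irrelevant: any site can be integrated
first. *)
Lemma expect_front (R : realType) (I : eqType) (s : seq I) (q : I -> R) F w y :
  (forall y, 0 <= q y < 1) -> (forall w, 0 <= F w)%E ->
  uniq s -> y \in s -> expect s q F w = expect (y :: rem y s) q F w.
Proof.
move=> hq F0; elim: s w => [|z s IH] w //= /andP[zs us].
rewrite inE; case: (eqVneq z y) => [->//|zy].
rewrite /= => ys.
transitivity (geo_mean (q z) (fun k => geo_mean (q y) (fun l =>
    expect (rem y s) q F (upd (upd w z k) y l)))).
  by apply: eq_geo_mean => k; rewrite IH.
rewrite geo_mean_exchange//; last by move=> k l; exact: expect_ge0.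
by apply: eq_geo_mean => l; apply: eq_geo_mean => k; rewrite updC.
Qed.

Lemma expect_perm (R : realType) (I : eqType) (s s' : seq I) (q : I -> R) F w :
  (forall y, 0 <= q y < 1) -> (forall w, 0 <= F w)%E ->
  uniq s -> perm_eq s s' -> expect s q F w = expect s' q F w.
Proof.
move=> hq F0; elim: s s' w => [|y s IH] s' w us ss'.
  by move: ss'; rewrite perm_sym => /perm_nilP ->.
have us' : uniq s' by rewrite -(perm_uniq ss').
have ys' : y \in s' by rewrite -(perm_mem ss') mem_head.
rewrite (expect_front _ _ _ us' ys')//=; apply: eq_geo_mean => k.
apply: IH; first by case/andP: us.
rewrite -(perm_cons y); exact: perm_trans ss' (perm_to_rem ys').
Qed.

Lemma expect_map (R : realType) (I J : eqType) (h : J -> I) (r : seq J)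
    (q : I -> R) F w : injective h ->
  expect (map h r) q (fun w => F (w \o h)) w = expect r (q \o h) F (w \o h).
Proof.
move=> hinj; elim: r w => [|y r IH] w //=; apply: eq_geo_mean => k.
rewrite IH; congr expect; apply/funext => z /=.
by rewrite /upd (inj_eq hinj).
Qed.

(** Marginal law: if F depends on the sites h y for y in r only, then the other
sites of s, as well as the initial configurations, are irrelevant. *)
Lemma expect_marginal (R : realType) (I J : eqType) (h : J -> I) (s : seq I)
    (r : seq J) (q : I -> R) F w w' : injective h ->
  (forall y, 0 <= q y < 1) -> (forall w, 0 <= F w)%E ->
  uniq s -> uniq r -> (forall y, y \in r -> h y \in s) ->
  (forall w w', {in r, w =1 w'} -> F w = F w') ->
  expect s q (fun w => F (w \o h)) w = expect r (q \o h) F w'.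
Proof.
move=> hinj hq F0 us ur rs Fr.
(* Integrate the sites outside the image of r first; they contribute 1. *)
pose s' := map h r ++ [seq y <- s | y \notin map h r].
have ss' : perm_eq s s'.
  apply: uniq_perm => //.
    rewrite cat_uniq map_inj_uniq// ur filter_uniq// andbT /=.
    by apply/hasPn => y; rewrite mem_filter => /andP[].
  move=> y; rewrite mem_cat mem_filter; case: (boolP (y \in map h r)) => //=.
  by move=> /mapP[z /rs zs ->].
rewrite (expect_perm _ _ _ us ss')// expect_cat.
transitivity (expect (map h r) q (fun w => F (w \o h)) w).
  apply: eq_expect => // w1 _; apply: expect_cst => // w2 Hw2; apply: Fr => z zr /=.
  by apply: Hw2; rewrite mem_filter map_f.
(* The starting configuration is irrelevant since every site read by F is
   integrated. *)
have F2 v v' : expect r (q \o h) F v = expect r (q \o h) F v'.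
  suff H (r1 : seq J) : forall v v', (forall y, y \in r -> y \notin r1 -> v y = v' y) ->
      expect r1 (q \o h) F v = expect r1 (q \o h) F v'.
    by apply: H => y ->.
  elim: r1 => [|y r1 IH] {}v {}v' vv' /=; first by apply: Fr => y yr; exact: vv'.
  apply: eq_geo_mean => k; apply: IH => z zr zr1; rewrite /upd.
  by case: eqVneq => // zy; apply: vv' => //; rewrite inE negb_or zy.
by rewrite expect_map//; exact: F2.
Qed.

Lemma expect_tilt1 (R : realType) (I : eqType) (s : seq I) (q : I -> R) (u : R)
    F w y :
  (forall y, 0 <= q y < 1) -> 0 <= u -> q y * u < 1 ->
  (forall w, 0 <= F w)%E -> uniq s -> y \in s ->
  expect s q (fun w => (u ^+ w y)%:E * F w)%E w =
  (((1 - q y) / (1 - q y * u))%R%:E *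
   expect s (fun z => if z == y then (q z * u)%R else q z) F w)%E.
Proof.
move=> hq u0 qu F0 us ys.
have hqu z : 0 <= (if z == y then q z * u else q z) < 1.
  case: eqVneq => // ->; rewrite qu andbT mulr_ge0//.
  by case/andP: (hq y).
have uF0 v : (0 <= (u ^+ v y)%:E * F v)%E.
  by rewrite mule_ge0// lee_fin exprn_ge0.
have yr : y \notin rem y s by rewrite mem_rem_uniq// inE eqxx.
rewrite (expect_front w hq uF0 us ys) (expect_front w hqu F0 us ys) /= eqxx.
rewrite -geo_mean_tilt//; last 2 first.
- by have := hqu y; rewrite eqxx.
- by move=> k; exact: expect_ge0.
apply: eq_geo_mean => k; rewrite -expectZ//.
apply: eq_expect => [z zs|w' Hw']; last by rewrite Hw'// upd_same.
by case: eqVneq => // zy; rewrite zy (negPf yr) in zs.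
Qed.

(** Tilting by u the weights of a set r of sites multiplies their parameters
by u, up to the normalizing factors. *)
Lemma expect_tilt (R : realType) (I : eqType) (s r : seq I) (q : I -> R) (u : R)
    F w :
  (forall y, 0 <= q y < 1) -> 0 <= u -> (forall y, y \in r -> q y * u < 1) ->
  (forall w, 0 <= F w)%E -> uniq s -> uniq r -> {subset r <= s} ->
  expect s q (fun w => (u ^+ (\sum_(y <- r) w y))%:E * F w)%E w =
  ((\prod_(y <- r) ((1 - q y) / (1 - q y * u)))%R%:E *
   expect s (fun z => if z \in r then (q z * u)%R else q z) F w)%E.
Proof.
move=> hq u0; elim: r q hq => [|y r IH] q hq qu F0 us /=.
  move=> _ _; rewrite big_nil mul1e.
  by apply: eq_expect => // w' _; rewrite big_nil expr0 mul1e.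
move=> /andP[yr ur] rs.
have qu' : q y * u < 1 by apply: qu; rewrite mem_head.
have ys : y \in s by apply: rs; rewrite mem_head.
have hqu z : 0 <= (if z == y then q z * u else q z) < 1.
  case: eqVneq => // ->; rewrite qu' andbT mulr_ge0//.
  by case/andP: (hq y).
transitivity (expect s q (fun w => (u ^+ w y)%:E *
    ((u ^+ (\sum_(y <- r) w y))%:E * F w))%E w).
  by apply: eq_expect => // w' _; rewrite big_cons exprD EFinM muleA.
rewrite expect_tilt1//; last first.
  by move=> v; rewrite mule_ge0// lee_fin exprn_ge0.
have neq z : z \in r -> (z == y) = false.
  by move=> zr; apply/eqP => zy; rewrite -zy zr in yr.
rewrite IH//; last 2 first.
- by move=> z zr; rewrite neq// qu// inE zr orbT.
- by move=> z zr; apply: rs; rewrite inE zr orbT.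
rewrite muleA -EFinM big_cons; congr (_%:E * _)%E.
  congr (_ * _); rewrite big_seq [RHS]big_seq.
  by apply: eq_bigr => z zr; rewrite neq.
apply: eq_expect => // z _; rewrite inE; case: (eqVneq z y) => [->|zy] /=.
  by rewrite (negPf yr).
by [].
Qed.

(** The involution [burke] acting on the values of w at three sites. *)
Definition burke_at (I : eqType) (y1 y2 y3 : I) (w : I -> nat) : I -> nat :=
  let b := burke (w y1, w y2, w y3) in
  upd (upd (upd w y1 b.1.1) y2 b.1.2) y3 b.2.

(** The law of the configuration is invariant under the involution. *)
Lemma expect_burke_at (R : realType) (I : eqType) (s : seq I) (q : I -> R) F w
    (y1 y2 y3 : I) :
  (forall y, 0 <= q y < 1) -> (forall w, 0 <= F w)%E -> uniq s ->
  y1 \in s -> y2 \in s -> y3 \in s ->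
  y1 != y2 -> y1 != y3 -> y2 != y3 -> q y1 * q y2 = q y3 ->
  expect s q (fun w => F (burke_at y1 y2 y3 w)) w = expect s q F w.
Proof.
move=> hq F0 us y1s y2s y3s n12 n13 n23 q12.
pose s' := rem y3 (rem y2 (rem y1 s)).
have E G : (forall w, 0 <= G w)%E ->
   expect s q G w = expect [:: y1, y2, y3 & s'] q G w.
  move=> G0; rewrite (expect_front w hq G0 us y1s) /=.
  apply: eq_geo_mean => k1; rewrite (@expect_front _ _ _ _ _ _ y2)//=; last 2 first.
  - exact: rem_uniq.
  - by rewrite mem_rem_uniq// inE eq_sym n12.
  apply: eq_geo_mean => k2; rewrite (@expect_front _ _ _ _ _ _ y3)//=; last 2 first.
  - by rewrite !rem_uniq.
  - by rewrite mem_rem_uniq ?rem_uniq// inE mem_rem_uniq// inE !(eq_sym y3) n23 n13.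
have m1 : y1 \notin s'.
  by apply/negP => /mem_rem /mem_rem; rewrite mem_rem_uniq// inE eqxx.
have m2 : y2 \notin s'.
  by apply/negP => /mem_rem; rewrite mem_rem_uniq ?rem_uniq// inE eqxx.
have m3 : y3 \notin s' by rewrite mem_rem_uniq ?rem_uniq// inE eqxx.
pose V x := upd (upd (upd w y1 x.1.1) y2 x.1.2) y3 x.2.
(* The involution commutes with the integration over all other sites. *)
have K (t : seq I) v : y1 \notin t -> y2 \notin t -> y3 \notin t ->
  expect t q (fun w => F (burke_at y1 y2 y3 w)) v = expect t q F (burke_at y1 y2 y3 v).
  elim: t v => [|y t IH] v //=; rewrite !inE !negb_or.
  move=> /andP[d1 t1] /andP[d2 t2] /andP[d3 t3]; apply: eq_geo_mean => k.
  rewrite IH//; congr expect; rewrite /burke_at !(upd_diff _ k)//.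
  apply/funext => z; rewrite /upd; case: (eqVneq z y) => [->|//].
  by rewrite !(eq_sym y) (negPf d1) (negPf d2) (negPf d3).
rewrite (E _ F0) (E (F \o burke_at y1 y2 y3)); last by move=> v; exact: F0.
rewrite /= -q12.
pose G x := expect s' q F (V x).
have G0 x : (0 <= G x)%E by exact: expect_ge0.
have := geo_mean_burke (hq y1) (hq y2) G0; rewrite /G /V /= => <-.
apply: eq_geo_mean => i; apply: eq_geo_mean => j; apply: eq_geo_mean => k.
rewrite K//; congr expect; rewrite /burke_at.
rewrite !upd_same (upd_diff _ _ n23) upd_same (upd_diff _ _ n13).
rewrite (upd_diff _ _ n12) upd_same.
apply/funext => z; rewrite /upd.
by case: (z == y3); case: (z == y2); case: (z == y1).
Qed.

(** * Last passage values by recursion *)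

(** The last passage value on the rectangle from (0, 0) to (i, j), defined by
recursion on the last step; the corner (0, 0) is included. *)
Fixpoint lpp (w : nat * nat -> nat) (i : nat) : nat -> nat :=
  fix lpp_row (j : nat) : nat :=
    match i, j with
    | 0, 0 => w (0, 0)
    | i'.+1, 0 => w (i, 0) + lpp w i' 0
    | 0, j'.+1 => w (0, j) + lpp_row j'
    | i'.+1, j'.+1 => w (i, j) + maxn (lpp w i' j) (lpp_row j')
    end%N.

Lemma lpp00 w : lpp w 0%N 0%N = w (0, 0)%N. Proof. by []. Qed.
Lemma lppS0 w i : (lpp w i.+1 0 = w (i.+1, 0) + lpp w i 0)%N.
Proof. by []. Qed.
Lemma lpp0S w j : lpp w 0 j.+1 = (w (0, j.+1) + lpp w 0 j)%N.
Proof. by []. Qed.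
Lemma lppSS w i j : lpp w i.+1 j.+1 =
  (w (i.+1, j.+1) + maxn (lpp w i j.+1) (lpp w i.+1 j))%N.
Proof. by []. Qed.
Opaque lpp.
Definition lppE := (lpp00, lppS0, lpp0S, lppSS).

(** Translation of the lattice by (k, l). *)
Definition offset (k l : nat) (y : nat * nat) : nat * nat :=
  (k + y.1, l + y.2)%N.

Lemma offset_inj k l : injective (offset k l).
Proof. by move=> [a b] [c d]; rewrite /offset /= => -[] /addnI -> /addnI ->. Qed.

Lemma offsetE (w : nat * nat -> nat) k l a b :
  (w \o offset k l) (a, b) = w (k + a, l + b)%N.
Proof. by []. Qed.

Lemma lpp_ext w w' i j :
  (forall a b, (a <= i)%N -> (b <= j)%N -> w (a, b) = w' (a, b)) ->
  lpp w i j = lpp w' i j.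
Proof.
elim: i j => [|i IHi]; elim=> [|j IHj] H; rewrite !lppE ?H//.
- by rewrite IHj// => a b ai bj; apply: H => //; exact: leqW.
- by rewrite IHi// => a b ai bj; apply: H => //; exact: leqW.
- rewrite IHj ?IHi// => a b ai bj; apply: H => //; exact: leqW.
Qed.

Lemma lpp_offset w k l i j :
  (lpp (w \o offset k l) i j <= lpp w (k + i) (l + j))%N.
Proof.
have H w' a b : (w' (a, b) <= lpp w' a b)%N.
  by case: a b => [|a] [|b]; rewrite !lppE; lia.
elim: i j => [|i IHi]; elim=> [|j IHj]; rewrite !lppE ?offsetE.
- exact: H.
- rewrite !addn0 !addnS in IHj *; case: k IHj => [|k] IHj; rewrite !lppE ?addn0; lia.
- have := IHi 0%N; rewrite !addn0 !addnS => {}IHi.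
  by case: l IHi => [|l] IHi; rewrite !lppE; lia.
- have := IHi j.+1; rewrite !addnS in IHj * => {}IHi.
  by rewrite lppSS; lia.
Qed.

(** The boundary sites (1, 0), ..., (n, 0). *)
Definition Hsites (n : nat) : seq (nat * nat) := [seq (i, 0%N) | i <- iota 1 n].
(** The boundary sites (0, 1), ..., (0, n). *)
Definition Vsites (n : nat) : seq (nat * nat) := [seq (0%N, i) | i <- iota 1 n].

(** The total weight of a list of sites. *)
Definition wsum (w : nat * nat -> nat) (s : seq (nat * nat)) : nat :=
  (\sum_(y <- s) w y)%N.

Lemma wsum_HS w n : wsum w (Hsites n.+1) = (wsum w (Hsites n) + w (n.+1, 0))%N.
Proof.
by rewrite /wsum /Hsites -(addn1 n) iotaD map_cat big_cat /= big_cons big_nil addn0 add1n addn1.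
Qed.

Lemma wsum_VS w n : wsum w (Vsites n.+1) = (wsum w (Vsites n) + w (0, n.+1))%N.
Proof.
by rewrite /wsum /Vsites -(addn1 n) iotaD map_cat big_cat /= big_cons big_nil addn0 add1n addn1.
Qed.

Lemma wsum_H_mono w m n : (m <= n)%N -> (wsum w (Hsites m) <= wsum w (Hsites n))%N.
Proof.
by move=> /subnKC <-; elim: (n - m)%N => [|k IH]; rewrite ?addn0// addnS wsum_HS; lia.
Qed.

Lemma wsum_V_mono w m n : (m <= n)%N -> (wsum w (Vsites m) <= wsum w (Vsites n))%N.
Proof.
by move=> /subnKC <-; elim: (n - m)%N => [|k IH]; rewrite ?addn0// addnS wsum_VS; lia.
Qed.

Lemma lpp_H w n : lpp w n 0%N = (w (0, 0) + wsum w (Hsites n))%N.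
Proof.
elim: n => [|n IH]; first by rewrite /wsum /Hsites big_nil addn0.
by rewrite lppS0 wsum_HS IH; lia.
Qed.

Lemma lpp_V w n : lpp w 0 n = (w (0, 0) + wsum w (Vsites n))%N.
Proof.
elim: n => [|n IH]; first by rewrite /wsum /Vsites big_nil addn0.
by rewrite lpp0S wsum_VS IH; lia.
Qed.

(** Exit point decomposition: an optimal path from a corner of weight 0 runs
along the boundary up to distance k + 1, steps into the bulk and stays there. *)
Lemma lpp_exit w N M : w (0, 0)%N = 0%N ->
  (exists2 k, (k <= N)%N & (lpp w N.+1 M.+1 <= wsum w (Hsites k.+1) +
      lpp (w \o offset k.+1 1) (N - k) M)%N) \/
  (exists2 l, (l <= M)%N & (lpp w N.+1 M.+1 <= wsum w (Vsites l.+1) +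
      lpp (w \o offset 1 l.+1) N (M - l))%N).
Proof.
move=> w0; elim: N M => [|N IHN]; elim=> [|M IHM].
- rewrite lppSS lpp_H lpp_V w0 !add0n; case: (leqP (wsum w (Hsites 1)) (wsum w (Vsites 1))) => h.
    by right; exists 0%N => //; rewrite lpp00 ?offsetE ?addn0 ?add1n; lia.
  by left; exists 0%N => //; rewrite lpp00 ?offsetE ?addn0 ?add1n; lia.
- rewrite lppSS lpp_V w0 add0n.
  case: (leqP (lpp w 1 M.+1) (wsum w (Vsites M.+2))) => h.
    right; exists M.+1 => //; rewrite subnn lpp00 ?offsetE ?addn0 ?add1n; lia.
  case: IHM => -[k kN H]; [left|right]; (exists k; first by lia).
  + move: kN H; rewrite leqn0 => /eqP -> H; rewrite subnn in H.
    by rewrite subnn lpp0S ?offsetE ?addn0 ?add1n; lia.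
  + by rewrite subSn// lpp0S ?offsetE ?addn0 ?add1n (_ : k.+1 + (M - k).+1 = M.+2)%N; lia.
- rewrite lppSS lpp_H w0 add0n.
  case: (leqP (lpp w N.+1 1) (wsum w (Hsites N.+2))) => h.
    by left; exists N.+1 => //; rewrite subnn lpp00 ?offsetE ?addn0 ?add1n; lia.
  case: (IHN 0%N) => -[k kN H]; [left|right]; (exists k; first by lia).
  + by rewrite subSn// lppS0 ?offsetE ?addn0 ?add1n (_ : k.+1 + (N - k).+1 = N.+2)%N; lia.
  + move: kN H; rewrite leqn0 => /eqP -> H; rewrite subnn in H.
    by rewrite subnn lppS0 ?offsetE ?addn0 ?add1n; lia.
- rewrite lppSS; case: (leqP (lpp w N.+2 M.+1) (lpp w N.+1 M.+2)) => h.
    case: (IHN M.+1) => -[k kN H]; [left|right]; (exists k; first by lia).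
    + rewrite subSn// (lppSS (w \o _)) ?offsetE ?addn0 ?add1n.
      by rewrite (_ : k.+1 + (N - k).+1 = N.+2)%N; lia.
    + case E : (M.+1 - k)%N H => [|m] H.
        have kE : k = M.+1 by lia.
        by subst k; rewrite (lppS0 (w \o _)) ?offsetE ?addn0 ?add1n; lia.
      rewrite (lppSS (w \o _)) ?offsetE ?addn0 ?add1n.
      by rewrite (_ : k.+1 + m.+1 = M.+2)%N; lia.
  case: IHM => -[k kN H]; [left|right]; (exists k; first by lia).
  + case E : (N.+1 - k)%N H => [|m] H.
      have kE : k = N.+1 by lia.
        by subst k; rewrite (lpp0S (w \o _)) ?offsetE ?addn0 ?add1n; lia.
    rewrite (lppSS (w \o _)) ?offsetE ?addn0 ?add1n.
    by rewrite (_ : k.+1 + m.+1 = N.+2)%N; lia.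
  + rewrite subSn// (lppSS (w \o _)) ?offsetE ?addn0 ?add1n.
    by rewrite (_ : k.+1 + (M - k).+1 = M.+2)%N; lia.
Qed.

(** * Sweeping the involution over a rectangle *)

(** The involution at the site (i, j).  Its slots (i, 0) and (0, j) carry the
increments that are currently incident to the site. *)
Definition burke_site (i j : nat) : (nat * nat -> nat) -> (nat * nat -> nat) :=
  burke_at (i, 0%N) (0%N, j) (i, j).

(** The sites (i, 1), ..., (i, m), treated from bottom to top. *)
Fixpoint burke_col (i m : nat) (w : nat * nat -> nat) : nat * nat -> nat :=
  if m is m'.+1 then burke_site i m (burke_col i m' w) else w.

(** The columns 1, ..., n, treated from left to right. *)
Fixpoint burke_all (n m : nat) (w : nat * nat -> nat) : nat * nat -> nat :=
  if n is n'.+1 then burke_col n m (burke_all n' m w) else w.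

Lemma burke_siteE i j w y : burke_site i.+1 j.+1 w y =
  if y == (i.+1, j.+1) then minn (w (i.+1, 0%N)) (w (0%N, j.+1))
  else if y == (0%N, j.+1) then
    (w (i.+1, j.+1) + (w (0%N, j.+1) - w (i.+1, 0%N)))%N
  else if y == (i.+1, 0%N) then
    (w (i.+1, j.+1) + (w (i.+1, 0%N) - w (0%N, j.+1)))%N
  else w y.
Proof. by rewrite /burke_site /burke_at /upd /burke /=. Qed.

(** Once column n + 1 has been treated up to height m, the slot (n + 1, 0) holds
the horizontal increment at height m, and the slots (0, j) hold the vertical
increments along column n + 1 for j <= m, along column n for j > m. *)
Lemma burke_colP (w v : nat * nat -> nat) (n m M : nat) : (m <= M)%N ->
  (forall j, (j < M)%N -> lpp w n j.+1 = lpp w n j + v (0%N, j.+1))%N ->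
  (forall i j, (n < i)%N -> v (i, j) = w (i, j)) ->
  let v' := burke_col n.+1 m v in
  [/\ (lpp w n m + v' (n.+1, 0) = lpp w n.+1 m)%N,
   (forall j, (j < m)%N -> lpp w n.+1 j.+1 = lpp w n.+1 j + v' (0, j.+1))%N,
   (forall j, (m <= j)%N -> v' (0, j.+1)%N = v (0, j.+1)%N),
   (forall j, (m < j)%N -> v' (n.+1, j)%N = w (n.+1, j)%N) &
   (forall i j, (n.+1 < i)%N -> v' (i, j) = w (i, j))].
Proof.
move=> mM Hv Hw; elim: m mM => [|m IH] /= mM.
  split=> //; first by rewrite lppS0 Hw; lia.
  - by move=> j _; rewrite Hw.
  - by move=> i j ni; rewrite Hw//; lia.
have := IH (ltnW mM); set v1 := burke_col n.+1 m v => -[H1 H2 H3 H4 H5].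
have E := burke_siteE n m v1; split.
- rewrite E !xpair_eqE !eqxx /= lppSS (H4 m.+1)// (H3 m)// (Hv m)//.
  by have := H1; lia.
- move=> j; rewrite ltnS leq_eqVlt => /orP[/eqP ->|jm].
    rewrite E !xpair_eqE !eqxx /= lppSS (H4 m.+1)// (H3 m)// (Hv m)//.
    by have := H1; lia.
  by rewrite E !xpair_eqE /= eqSS ltn_eqF// H2.
- by move=> j mj; rewrite E !xpair_eqE /= eqSS gtn_eqF// H3// ltnW.
- move=> j mj; rewrite E !xpair_eqE !eqxx /= gtn_eqF//= gtn_eqF; last lia.
  by rewrite H4//; lia.
- by move=> i j ni; rewrite E !xpair_eqE gtn_eqF//= gtn_eqF//= ?H5//; lia.
Qed.

(** After n columns the slots (0, j) hold the vertical increments along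
column n. *)
Lemma burke_allP (w : nat * nat -> nat) (n m : nat) :
  let v := burke_all n m w in
  (forall j, (j < m)%N -> lpp w n j.+1 = lpp w n j + v (0, j.+1))%N /\
  (forall i j, (n < i)%N -> v (i, j) = w (i, j)).
Proof.
elim: n => [|n [IH1 IH2]] /=.
  by split => // j _; rewrite lpp0S addnC.
by have [_ H1 _ _ H2] := burke_colP (leqnn m) IH1 IH2.
Qed.

(** The last passage value is the sum of the increments along the bottom row
and then up the last column. *)
Lemma lpp_burke (w : nat * nat -> nat) (n m : nat) : w (0, 0)%N = 0%N ->
  (lpp w n m = wsum w (Hsites n) + wsum (burke_all n m w) (Vsites m))%N.
Proof.
move=> w0; have [H _] := burke_allP w n m.
have K k : (k <= m)%N ->
    (lpp w n k = wsum w (Hsites n) + wsum (burke_all n m w) (Vsites k))%N.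
  elim: k => [|k IH] km.
    by rewrite lpp_H w0 /wsum /Vsites big_nil addn0.
  by rewrite (H _ km) (IH (ltnW km)) (wsum_VS _ k) addnA.
exact: K.
Qed.

(** * Exponential moments of the model with boundary *)

(** The generating function at u of the law Geom(p). *)
Definition mgf (R : realType) (p u : R) : R := (1 - p) / (1 - p * u).

(** The parameters of the model with boundary: p on the bottom row, q on the left
column, l elsewhere.  The value at the corner is irrelevant since the corner is
never a random site. *)
Definition bfield (R : realType) (p q l : R) (y : nat * nat) : R :=
  if y.2 == 0%N then p else if y.1 == 0%N then q else l.

(** The sites (i, j) with i <= n and j <= m. *)
Definition rect (n m : nat) : seq (nat * nat) :=
  [seq (i, j) | i <- iota 0 n.+1, j <- iota 0 m.+1].

(** The random sites of the model with boundary: all but the corner, whose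
weight is 0. *)
Definition bsites (n m : nat) : seq (nat * nat) :=
  [seq y <- rect n m | y != (0, 0)%N].

Lemma mem_rect n m y : (y \in rect n m) = (y.1 <= n)%N && (y.2 <= m)%N.
Proof.
apply/allpairsP/andP => [[[i j] [hi hj ->]]|[h1 h2]].
  by move: hi hj; rewrite !mem_iota /=; lia.
by exists y; split; rewrite ?mem_iota ?ltnS//=; case: y {h1 h2}.
Qed.

Lemma mem_bsites n m y :
  (y \in bsites n m) = [&& y != (0, 0)%N, (y.1 <= n)%N & (y.2 <= m)%N].
Proof. by rewrite mem_filter mem_rect. Qed.

Lemma rect_uniq n m : uniq (rect n m).
Proof. by apply: allpairs_uniq; rewrite ?iota_uniq// => -[? ?] [? ?]. Qed.

Lemma bsites_uniq n m : uniq (bsites n m).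
Proof. exact/filter_uniq/rect_uniq. Qed.

Lemma mem_Hsites n y : (y \in Hsites n) = [&& y.2 == 0, 0 < y.1 & y.1 <= n]%N.
Proof.
apply/mapP/idP => [[i + ->] /=|/and3P[/eqP y2 y1 yn]].
  by rewrite mem_iota; lia.
exists y.1; first by rewrite mem_iota; lia.
by case: y {y1 yn} y2 => ? ? /= ->.
Qed.

Lemma mem_Vsites n y : (y \in Vsites n) = [&& y.1 == 0, 0 < y.2 & y.2 <= n]%N.
Proof.
apply/mapP/idP => [[i + ->] /=|/and3P[/eqP y2 y1 yn]].
  by rewrite mem_iota; lia.
exists y.2; first by rewrite mem_iota; lia.
by case: y {y1 yn} y2 => ? ? /= ->.
Qed.

Lemma Hsites_uniq n : uniq (Hsites n).
Proof. by rewrite map_inj_uniq ?iota_uniq// => i j []. Qed.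

Lemma Vsites_uniq n : uniq (Vsites n).
Proof. by rewrite map_inj_uniq ?iota_uniq// => i j []. Qed.

Lemma bfield_itv (R : realType) (p q l : R) :
  0 <= p < 1 -> 0 <= q < 1 -> 0 <= l < 1 ->
  forall y, 0 <= bfield p q l y < 1.
Proof. by move=> hp hq hl y; rewrite /bfield; case: ifP => // _; case: ifP. Qed.

Lemma prod_Hsites (R : realType) (f : nat * nat -> R) c n :
  (forall i, f (i, 0%N) = c) -> \prod_(y <- Hsites n) f y = c ^+ n.
Proof.
move=> fc; rewrite /Hsites big_map (eq_bigr (fun=> c))// big_const_seq.
by rewrite count_predT size_iota iter_mulr_1.
Qed.

Lemma prod_Vsites (R : realType) (f : nat * nat -> R) c n :
  (forall i, f (0%N, i.+1) = c) -> \prod_(y <- Vsites n) f y = c ^+ n.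
Proof.
move=> fc; rewrite /Vsites big_map big_seq (eq_bigr (fun=> c)).
  by rewrite -big_seq big_const_seq count_predT size_iota iter_mulr_1.
by case=> [|i]; rewrite mem_iota.
Qed.

Lemma expect_burke_col (R : realType) (s : seq (nat * nat)) (q : nat * nat -> R)
    F w i m :
  (forall y, 0 <= q y < 1) -> (forall w, 0 <= F w)%E -> uniq s ->
  (i.+1, 0%N) \in s -> (forall j, (0 < j <= m)%N -> (0%N, j) \in s) ->
  (forall j, (0 < j <= m)%N -> (i.+1, j) \in s) ->
  (forall j, (0 < j <= m)%N -> q (i.+1, 0%N) * q (0%N, j) = q (i.+1, j)) ->
  expect s q (F \o burke_col i.+1 m) w = expect s q F w.
Proof.
move=> hq + us si; elim: m F => [//|m IH] F F0 s0 ss qq.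
transitivity (expect s q ((F \o burke_site i.+1 m.+1) \o burke_col i.+1 m) w) => //.
rewrite IH => [| |j hj|j hj|j hj]; last 3 first.
- by apply: s0; lia.
- by apply: ss; lia.
- by apply: qq; lia.
- apply: (@expect_burke_at _ _ _ _ _ _ (i.+1, 0%N) (0%N, m.+1) (i.+1, m.+1)).
  all: first [by [] | by apply: s0; rewrite /= leqnn
    | by apply: ss; rewrite /= leqnn | by apply: qq; rewrite /= leqnn
    | by rewrite xpair_eqE andbF
    | by move=> v; exact: F0].
Qed.

Lemma expect_burke_all (R : realType) (p q : R) F w n m :
  0 <= p < 1 -> 0 <= q < 1 -> (forall w, 0 <= F w)%E ->
  expect (bsites n m) (bfield p q (p * q)) (F \o burke_all n m) w =
  expect (bsites n m) (bfield p q (p * q)) F w.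
Proof.
move=> hp hq.
have hl : 0 <= p * q < 1.
  by move: hp hq => /andP[? ?] /andP[? ?]; rewrite mulr_ge0//= mulr_ilt1.
have hb := bfield_itv hp hq hl.
have H k : (k <= n)%N -> forall F, (forall w, 0 <= F w)%E ->
  expect (bsites n m) (bfield p q (p * q)) (F \o burke_all k m) w =
  expect (bsites n m) (bfield p q (p * q)) F w.
  elim: k => [//|k IH] kn {}F F0.
  transitivity (expect (bsites n m) (bfield p q (p * q))
     ((F \o burke_col k.+1 m) \o burke_all k m) w) => //.
  rewrite (IH (ltnW kn) (F \o burke_col k.+1 m)); last by move=> v; exact: F0.
  apply: expect_burke_col => // [||j hj|j hj|j hj].
  - exact: bsites_uniq.
  - by rewrite mem_bsites /=; lia.
  - by rewrite mem_bsites /= ?xpair_eqE /=; lia.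
  - by rewrite mem_bsites /= ?xpair_eqE /=; lia.
  - by rewrite /bfield /=; case: j hj.
exact: H.
Qed.

(** Generating function of the last passage value with boundary.  Tilting the
bottom row by u gives it the parameter p u, for which Burke's property applies
since (p u) q is the bulk parameter; what remains is the generating function of
the left column. *)
Lemma expect_boundary (R : realType) (p q u : R) n m :
  0 <= p < 1 -> 0 <= q < 1 -> 0 < u -> p * u < 1 -> q * u < 1 ->
  expect (bsites n m) (bfield p q (p * q * u)) (fun w => (u ^+ lpp w n m)%:E)
    (fun=> 0%N) = (mgf p u ^+ n * mgf q u ^+ m)%:E.
Proof.
move=> hp hq u0 pu qu.
have p0 : 0 <= p by case/andP: hp.
have q0 : 0 <= q by case/andP: hq.
have hpu : 0 <= p * u < 1 by rewrite pu mulr_ge0// ltW.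
have hqu : 0 <= q * u < 1 by rewrite qu mulr_ge0// ltW.
have hl : 0 <= p * u * q < 1.
  by move: hpu hq => /andP[? ?] /andP[? ?]; rewrite mulr_ge0//= mulr_ilt1.
rewrite (_ : p * q * u = p * u * q); last by rewrite mulrAC.
have hb := bfield_itv hp hq hl.
have hb' := bfield_itv hpu hq hl.
have pos v k : (0 <= (u ^+ wsum v k)%:E)%E by rewrite lee_fin exprn_ge0// ltW.
transitivity (expect (bsites n m) (bfield p q (p * u * q))
   (fun w => (u ^+ (\sum_(y <- Hsites n) w y))%:E *
     (u ^+ wsum (burke_all n m w) (Vsites m))%:E)%E (fun=> 0%N)).
  apply: eq_expect => // w' Hw'; rewrite lpp_burke ?exprD//.
  by rewrite Hw'// mem_bsites.
rewrite expect_tilt//; last 5 first.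
- exact: ltW.
- by move=> y; rewrite mem_Hsites /bfield => /and3P[-> _ _].
- exact: bsites_uniq.
- exact: Hsites_uniq.
- move=> y; rewrite mem_Hsites mem_bsites => /and3P[/eqP y2 y1 yn].
  by rewrite y2 yn andbT; case: y y1 y2 {yn} => -[|a] b //= _ ->.
rewrite (@prod_Hsites _ _ (mgf p u))// EFinM; congr (_ * _)%E.
transitivity (expect (bsites n m) (bfield (p * u) q (p * u * q))
    ((fun w => (u ^+ wsum w (Vsites m))%:E) \o burke_all n m) (fun=> 0%N)).
  apply: eq_expect => // y; rewrite mem_bsites mem_Hsites /bfield.
  case: y => [[|a] [|b]] //= /andP[]//.
  by move=> ->.
rewrite expect_burke_all//.
transitivity (expect (bsites n m) (bfield (p * u) q (p * u * q))
   (fun w => (u ^+ (\sum_(y <- Vsites m) w y))%:E * 1)%E (fun=> 0%N)).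
  by apply: eq_expect => // w' _; rewrite mule1.
rewrite expect_tilt//; last 5 first.
- exact: ltW.
- move=> y; rewrite mem_Vsites /bfield => /and3P[-> y2 _].
  by rewrite (gtn_eqF y2).
- exact: bsites_uniq.
- exact: Vsites_uniq.
- move=> y; rewrite mem_Vsites mem_bsites => /and3P[/eqP y1 y2 yn].
  by rewrite y1 yn andbT; case: y y1 y2 {yn} => a -[|b] //= ->.
rewrite (@prod_Vsites _ _ (mgf q u))// expect_cst ?mule1// => y.
case: ifP => // /[!mem_Vsites] /and3P[h1 h2 _].
by rewrite /bfield (gtn_eqF h2) h1.
Qed.

Lemma offset11_bsites n m y :
  y \in rect n m -> offset 1 1 y \in bsites n.+1 m.+1.
Proof. by rewrite mem_rect mem_bsites. Qed.

(** A bulk rectangle is dominated by a model with a boundary around it, which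
need not be related to the other weights of the configuration. *)
Lemma expect_bulk_le (R : realType) (p q u : R) (s : seq (nat * nat))
    (fld : nat * nat -> R) (k l n m : nat) w :
  0 <= p < 1 -> 0 <= q < 1 -> 1 <= u -> p * u < 1 -> q * u < 1 ->
  (forall y, 0 <= fld y < 1) -> uniq s ->
  (forall y, y \in rect n m -> offset k l y \in s) ->
  (forall y, y \in rect n m -> fld (offset k l y) = p * q * u) ->
  (expect s fld (fun v => (u ^+ lpp (v \o offset k l) n m)%:E) w
   <= (mgf p u ^+ n.+1 * mgf q u ^+ m.+1)%:E)%E.
Proof.
move=> hp hq u1 pu qu hf us rs fr.
have u0 : 0 < u by exact: lt_le_trans u1.
have p0 : 0 <= p by case/andP: hp.
have q0 : 0 <= q by case/andP: hq.
have hl : 0 <= p * q * u < 1.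
  have q1 : q < 1 by case/andP: hq.
  apply/andP; split; first by rewrite !mulr_ge0// ltW.
  by rewrite mulrAC mulr_ilt1// mulr_ge0// ltW.
have hb := bfield_itv hp hq hl.
have pos i : (0 <= (u ^+ i)%:E)%E by rewrite lee_fin exprn_ge0// ltW.
pose F v := (u ^+ lpp v n m)%:E.
have Fr v v' : {in rect n m, v =1 v'} -> F v = F v'.
  by move=> vv; congr (_ ^+ _)%:E; apply: lpp_ext => a b an bm; apply: vv;
    rewrite mem_rect an.
rewrite -(expect_boundary n.+1 m.+1 hp hq u0 pu qu).
apply: (@le_trans _ _ (expect (bsites n.+1 m.+1) (bfield p q (p * q * u))
   (fun v => F (v \o offset 1 1)) (fun=> 0%N))); last first.
  apply: le_expect => // [v|v _]; first exact: pos.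
  rewrite lee_fin ler_weXn2l//; exact: lpp_offset.
have pF v : (0 <= F v)%E by exact: pos.
have -> : expect (bsites n.+1 m.+1) (bfield p q (p * q * u))
      (fun v => F (v \o offset 1 1)) (fun=> 0%N) =
    expect (rect n m) (bfield p q (p * q * u) \o offset 1 1) F (fun=> 0%N).
  apply: (expect_marginal _ _ (@offset_inj 1 1) hb pF (bsites_uniq _ _)
    (rect_uniq _ _)) => // y.
  exact: offset11_bsites.
have -> : expect s fld (fun v => F (v \o offset k l)) w =
    expect (rect n m) (fld \o offset k l) F (fun=> 0%N).
  exact: (expect_marginal _ _ (@offset_inj k l) hf pF us (rect_uniq _ _)).
rewrite le_eqVlt; apply/orP; left; apply/eqP; exact: eq_expect.
Qed.

(** * Exponential bounds for boundary strings and for the upper tail *)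

(** The mean of the law Geom(x). *)
Definition gmean (R : realType) (x : R) : R := x / (1 - x).

Lemma gmean_ge0 (R : realType) (x : R) : 0 <= x < 1 -> 0 <= gmean x.
Proof. by case/andP=> x0 x1; rewrite divr_ge0// subr_ge0 ltW. Qed.

Lemma mgf_gt0 (R : realType) (p u : R) : p < 1 -> p * u < 1 -> 0 < mgf p u.
Proof. by move=> p1 pu; rewrite divr_gt0// subr_gt0. Qed.

(** Convexity of log mgf, as a function of log u: the logarithmic derivative at u
is gmean (p u). *)
Lemma mgf_le (R : realType) (p u : R) : 0 <= p -> 0 < u -> p * u < 1 ->
  mgf p u <= u `^ gmean (p * u).
Proof.
move=> p0 u0 pu; have d0 : 0 < 1 - p * u by rewrite subr_gt0.
rewrite /powR gt_eqF//.
apply: (@le_trans _ _ (expR (p * (u - 1) / (1 - p * u)))).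
  apply: le_trans (expR_ge1Dx _); rewrite /mgf le_eqVlt; apply/orP; left.
  by apply/eqP; field; rewrite gt_eqF.
rewrite ler_expR.
have -> : p * (u - 1) / (1 - p * u) = gmean (p * u) * (1 - u^-1).
  by rewrite /gmean; field; rewrite !gt_eqF.
apply: ler_wpM2l; first by rewrite divr_ge0// ?mulr_ge0// ltW.
have h : ln u^-1 <= u^-1 - 1.
  have := @le_ln1Dx R (u^-1 - 1); rewrite (_ : 1 + (u^-1 - 1) = u^-1); [apply|ring].
  by rewrite ltrBrDl subrr invr_gt0.
by move: h; rewrite lnV ?posrE//; lra.
Qed.

Lemma mgf_exp_le (R : realType) (p u : R) n : 0 <= p < 1 -> 0 < u -> p * u < 1 ->
  mgf p u ^+ n <= u `^ (n%:R * gmean (p * u)).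
Proof.
move=> /andP[p0 p1] u0 pu; rewrite mulrC powRrM powR_mulrn ?powR_ge0//.
rewrite lerXn2r ?nnegrE ?powR_ge0//; first exact/ltW/mgf_gt0.
exact: mgf_le.
Qed.

Lemma mgf_exp2_le (R : realType) (p q u : R) n m :
  0 <= p < 1 -> 0 <= q < 1 -> 0 < u -> p * u < 1 -> q * u < 1 ->
  mgf p u ^+ n * mgf q u ^+ m <=
  u `^ (n%:R * gmean (p * u) + m%:R * gmean (q * u)).
Proof.
move=> hp hq u0 pu qu; rewrite powRD; last by rewrite (gt_eqF u0) implybT.
have /andP[p0 p1] := hp; have /andP[q0 q1] := hq.
apply: ler_pM; rewrite ?mgf_exp_le//; exact/exprn_ge0/ltW/mgf_gt0.
Qed.

(** Exponential moment of the sum of a string r of i.i.d. boundary weights and of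
the last passage value of a rectangle that avoids the string. *)
Lemma expect_string_bulk_le (R : realType) (c p q t : R) (s r : seq (nat * nat))
    (fld : nat * nat -> R) (k l n m : nat) w :
  0 <= p < 1 -> 0 <= q < 1 ->
  1 <= t -> c * t < 1 -> p * t < 1 -> q * t < 1 ->
  (forall y, 0 <= fld y < 1) -> uniq s -> uniq r -> {subset r <= s} ->
  (forall y, y \in r -> fld y = c) ->
  (forall y, y \in rect n m -> [/\ offset k l y \in s,
     offset k l y \notin r & fld (offset k l y) = p * q * t]) ->
  0 <= c < 1 ->
  (expect s fld (fun w =>
     (t ^+ (wsum w r + lpp (w \o offset k l) n m))%:E) w <=
   (t `^ ((size r)%:R * gmean (c * t) + (n.+1%:R * gmean (p * t)
       + m.+1%:R * gmean (q * t))))%:E)%E.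
Proof.
move=> hp hq t1 ct pt qt hf us ur rs fr frect hc.
have t0 : 0 < t by exact: lt_le_trans t1.
have hct : 0 <= c * t < 1.
  by rewrite ct andbT mulr_ge0 ?(ltW t0)//; case/andP: hc.
have c1 : c < 1 by case/andP: hc.
have pos i : (0 <= (t ^+ i)%:E)%E by rewrite lee_fin exprn_ge0// ltW.
pose fld' z := if z \in r then fld z * t else fld z.
have hf' y : 0 <= fld' y < 1.
  by rewrite /fld'; case: ifP => // yr; rewrite fr.
pose L (w : nat * nat -> nat) := lpp (w \o offset k l) n m.
have -> : expect s fld (fun w => (t ^+ (wsum w r + L w))%:E) w =
  ((mgf c t ^+ size r)%:E * expect s fld' (fun w => (t ^+ L w)%:E) w)%E.
  transitivity (expect s fld (fun w =>
     (t ^+ (\sum_(y <- r) w y))%:E * (t ^+ L w)%:E)%E w).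
    by apply: eq_expect => // w' _; rewrite exprD.
  rewrite expect_tilt//; last 2 first.
  - exact: ltW.
  - by move=> y yr; rewrite fr.
  congr (_%:E * _)%E; rewrite big_seq (eq_bigr (fun=> mgf c t)) => [|y yr].
    by rewrite -big_seq big_const_seq count_predT iter_mulr_1.
  by rewrite fr.
apply: (@le_trans _ _ ((mgf c t ^+ size r)%:E *
    (mgf p t ^+ n.+1 * mgf q t ^+ m.+1)%:E)%E).
  apply: lee_wpmul2l; first by rewrite lee_fin exprn_ge0// ltW// mgf_gt0.
  apply: expect_bulk_le => // y /frect[] // _ yr fy.
  by rewrite /fld' (negPf yr).
rewrite -EFinM lee_fin powRD; last by rewrite (gt_eqF t0) implybT.
apply: ler_pM; rewrite ?mgf_exp_le ?mgf_exp2_le//.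
  by rewrite exprn_ge0// ltW// mgf_gt0.
by rewrite mulr_ge0// exprn_ge0// ltW// mgf_gt0//; [case/andP: hp|case/andP: hq].
Qed.

Lemma size_Hsites n : size (Hsites n) = n.
Proof. by rewrite size_map size_iota. Qed.

Lemma size_Vsites n : size (Vsites n) = n.
Proof. by rewrite size_map size_iota. Qed.

Lemma Hsites_sub k n m : (k <= n)%N -> {subset Hsites k <= bsites n m}.
Proof.
move=> kn y; rewrite mem_Hsites mem_bsites => /and3P[/eqP y2 y1 yk].
by rewrite y2 (leq_trans yk)//; case: y y1 {yk y2} => -[|a] b.
Qed.

Lemma Vsites_sub k n m : (k <= m)%N -> {subset Vsites k <= bsites n m}.
Proof.
move=> km y; rewrite mem_Vsites mem_bsites => /and3P[/eqP y1 y2 yk].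
by rewrite y1 (leq_trans yk)//; case: y y2 {yk y1} => -[|a] -[|b].
Qed.

(** Exit through the bottom row. *)
Lemma expect_exitH_le (R : realType) (p q l p' q' t : R) n m k :
  0 <= p < 1 -> 0 <= q < 1 -> 0 <= l < 1 -> 0 <= p' < 1 -> 0 <= q' < 1 ->
  1 <= t -> p * t < 1 -> p' * t < 1 -> q' * t < 1 -> p' * q' * t = l ->
  (k <= n)%N ->
  (expect (bsites n.+1 m.+1) (bfield p q l) (fun w =>
     (t ^+ (wsum w (Hsites k.+1) + lpp (w \o offset k.+1 1) (n - k) m))%:E)
     (fun=> 0%N) <=
   (t `^ (k.+1%:R * gmean (p * t) + ((n - k).+1%:R * gmean (p' * t)
       + m.+1%:R * gmean (q' * t))))%:E)%E.
Proof.
move=> hp hq hl hp' hq' t1 pt p't q't E kn.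
rewrite -[X in (X%:R * gmean (p * t))](size_Hsites k.+1).
apply: expect_string_bulk_le => //.
- exact: bfield_itv.
- exact: bsites_uniq.
- exact: Hsites_uniq.
- exact: Hsites_sub.
- by move=> y; rewrite mem_Hsites /bfield => /and3P[-> _ _].
- move=> [a b]; rewrite mem_rect /= => /andP[ab bm].
  split.
  + rewrite mem_bsites; apply/and3P; split=> //.
    by change (k.+1 + a <= n.+1)%N; move: ab kn; clear; lia.
  + by apply/negP; rewrite mem_Hsites => /and3P[].
  rewrite /offset.
  by rewrite /bfield add1n addSn /= E.
Qed.

(** Exit through the left column. *)
Lemma expect_exitV_le (R : realType) (p q l p' q' t : R) n m k :
  0 <= p < 1 -> 0 <= q < 1 -> 0 <= l < 1 -> 0 <= p' < 1 -> 0 <= q' < 1 ->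
  1 <= t -> q * t < 1 -> p' * t < 1 -> q' * t < 1 -> p' * q' * t = l ->
  (k <= m)%N ->
  (expect (bsites n.+1 m.+1) (bfield p q l) (fun w =>
     (t ^+ (wsum w (Vsites k.+1) + lpp (w \o offset 1 k.+1) n (m - k)))%:E)
     (fun=> 0%N) <=
   (t `^ (k.+1%:R * gmean (q * t) + (n.+1%:R * gmean (p' * t)
       + (m - k).+1%:R * gmean (q' * t))))%:E)%E.
Proof.
move=> hp hq hl hp' hq' t1 qt p't q't E km.
rewrite -[X in (X%:R * gmean (q * t))](size_Vsites k.+1).
apply: expect_string_bulk_le => //.
- exact: bfield_itv.
- exact: bsites_uniq.
- exact: Vsites_uniq.
- exact: Vsites_sub.
- move=> y; rewrite mem_Vsites /bfield => /and3P[-> y2 _].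
  by rewrite (gtn_eqF y2).
- move=> [a b]; rewrite mem_rect /= => /andP[ab bm].
  split.
  + rewrite mem_bsites; apply/and3P; split=> //.
    by change (k.+1 + b <= m.+1)%N; move: bm km; clear; lia.
  + by apply/negP; rewrite mem_Vsites => /and3P[].
  rewrite /offset.
  by rewrite /bfield E.
Qed.

Lemma expect_string_le (R : realType) (c t : R) (s r : seq (nat * nat))
    (fld : nat * nat -> R) w :
  0 <= c < 1 -> 0 < t -> c * t < 1 ->
  (forall y, 0 <= fld y < 1) -> uniq s -> uniq r -> {subset r <= s} ->
  (forall y, y \in r -> fld y = c) ->
  (expect s fld (fun w => (t ^+ wsum w r)%:E) w <=
   (t `^ ((size r)%:R * gmean (c * t)))%:E)%E.
Proof.
move=> hc t0 ct hf us ur rs fr.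
have hct : 0 <= c * t < 1.
  by rewrite ct andbT mulr_ge0 ?(ltW t0)//; case/andP: hc.
have -> : expect s fld (fun w => (t ^+ wsum w r)%:E) w =
    expect s fld (fun w => (t ^+ (\sum_(y <- r) w y))%:E * 1)%E w.
  by apply: eq_expect => // w' _; rewrite mule1.
rewrite expect_tilt//; last 2 first.
- exact: ltW.
- by move=> y yr; rewrite fr.
rewrite expect_cst ?mule1//; last by move=> y; case: ifP => // yr; rewrite fr.
rewrite lee_fin big_seq (eq_bigr (fun=> mgf c t)) => [|y yr]; last by rewrite fr.
by rewrite -big_seq big_const_seq count_predT iter_mulr_1 mgf_exp_le.
Qed.

(** Exponential Markov inequality for the value in the bulk to be large. *)
Lemma expect_upper_tail (R : realType) (p q t x : R) n m w :
  0 <= p < 1 -> 0 <= q < 1 -> 1 <= t -> p * t < 1 -> q * t < 1 ->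
  (expect (rect n m) (fun=> (p * q * t)%R)
      (fun w => ((x <= (lpp w n m)%:R)%R%:R : R)%:E) w <=
   (t `^ (n.+1%:R * gmean (p * t) + m.+1%:R * gmean (q * t) - x))%:E)%E.
Proof.
move=> hp hq t1 pt qt.
have t0 : 0 < t by exact: lt_le_trans t1.
have p0 : 0 <= p by case/andP: hp.
have q0 : 0 <= q by case/andP: hq.
have hl : 0 <= p * q * t < 1.
  have q1 : q < 1 by case/andP: hq.
  apply/andP; split; first by rewrite !mulr_ge0// ltW.
  by rewrite mulrAC mulr_ilt1// mulr_ge0// ltW.
pose G (v : nat * nat -> nat) := lpp (v \o offset 0 0) n m.
have GE v : lpp v n m = G v.
  by apply: lpp_ext => a b _ _; rewrite offsetE.
apply: (@le_trans _ _ (expect (rect n m) (fun=> p * q * t)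
    (fun w => (t `^ (- x))%:E * (t ^+ G w)%:E)%E w)).
  apply: le_expect => // v _.
  rewrite -EFinM lee_fin GE; case: (lerP x) => [xG|_]; last first.
    by rewrite mulr_ge0 ?powR_ge0// exprn_ge0// ltW.
  rewrite -powR_mulrn ?(ltW t0)// -powRD ?(gt_eqF t0) ?implybT//.
  by rewrite -[leLHS](powRr0 t) ler_powR// addrC subr_ge0.
rewrite expectZ//; last by move=> v; rewrite lee_fin exprn_ge0// ltW.
apply: (@le_trans _ _ ((t `^ (- x))%:E *
   (mgf p t ^+ n.+1 * mgf q t ^+ m.+1)%:E)%E).
  apply: lee_wpmul2l; first by rewrite lee_fin powR_ge0.
  apply: expect_bulk_le => //; first exact: rect_uniq.
  by case.
rewrite -EFinM lee_fin addrC powRD ?(gt_eqF t0) ?implybT//.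
by apply: ler_wpM2l; rewrite ?powR_ge0// mgf_exp2_le.
Qed.

(** * Exponential bound for the lower tail *)

Lemma le1_powR_exprn (R : realType) (t z : R) i : 1 <= t -> z <= i%:R ->
  1 <= t `^ (- z) * t ^+ i.
Proof.
move=> t1 zi; have t0 : 0 < t by exact: lt_le_trans t1.
rewrite -powR_mulrn ?(ltW t0)// -powRD ?(gt_eqF t0) ?implybT//.
by rewrite -[leLHS](powRr0 t) ler_powR// addrC subr_ge0.
Qed.

Lemma powRB_comm (R : realType) (t a z : R) : 0 < t ->
  t `^ (a - z) = t `^ (- z) * t `^ a.
Proof. by move=> t0; rewrite addrC powRD// (gt_eqF t0) implybT. Qed.

(** If the value in the bulk is at most x, then one of the following occurs: the
value with boundary is at most x + y; one of the initial stretches of the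
boundary, of lengths k0 and l0, has weight more than y; some exit beyond these
stretches has value more than x + y.  Each indicator is bounded by an
exponential. *)
Lemma lower_tail_pointwise (R : realType) (t x y : R) (n m k0 l0 : nat)
    (w : nat * nat -> nat) :
  1 <= t -> w (0, 0)%N = 0%N ->
  (((lpp (w \o offset 1 1) n m)%:R <= x)%R%:R : R) <=
  t `^ (x + y) * t^-1 ^+ lpp w n.+1 m.+1
  + (t `^ (- y) * t ^+ wsum w (Hsites k0)
  + (t `^ (- y) * t ^+ wsum w (Vsites l0)
  + (\sum_(k0 <= k < n.+1) t `^ (- (x + y)) *
       t ^+ (wsum w (Hsites k.+1) + lpp (w \o offset k.+1 1) (n - k) m)
  + \sum_(l0 <= l < m.+1) t `^ (- (x + y)) *
       t ^+ (wsum w (Vsites l.+1) + lpp (w \o offset 1 l.+1) n (m - l))))).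
Proof.
move=> t1 w0; have t0 : 0 < t by exact: lt_le_trans t1.
set A := _ * t^-1 ^+ _; set B := _ * _ ^+ wsum w (Hsites k0).
set C := _ * _ ^+ wsum w (Vsites l0); set D := \sum_(_ <= _ < n.+1) _.
set E := \sum_(_ <= _ < m.+1) _.
have A0 : 0 <= A by rewrite mulr_ge0 ?powR_ge0// exprn_ge0// invr_ge0 ltW.
have B0 : 0 <= B by rewrite mulr_ge0 ?powR_ge0// exprn_ge0// ltW.
have C0 : 0 <= C by rewrite mulr_ge0 ?powR_ge0// exprn_ge0// ltW.
have D0 : 0 <= D.
  by apply: sumr_ge0 => i _; rewrite mulr_ge0 ?powR_ge0// exprn_ge0// ltW.
have E0 : 0 <= E.
  by apply: sumr_ge0 => i _; rewrite mulr_ge0 ?powR_ge0// exprn_ge0// ltW.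
case: (lerP _ x) => [Lx|_]; last by rewrite [leLHS](_ : _ = 0)//; lra.
suff : [\/ 1 <= A, 1 <= B, 1 <= C | 1 <= D \/ 1 <= E].
  by case=> [?|?|?|[?|?]]; rewrite [leLHS](_ : _ = 1)//; lra.
have [Gxy|Gxy] := lerP (lpp w n.+1 m.+1)%:R (x + y).
  constructor 1; rewrite /A exprVn -powR_invn ?(ltW t0)// -powRD ?(gt_eqF t0) ?implybT//.
  by rewrite -[leLHS](powRr0 t) ler_powR// subr_ge0.
have [[k kn H]|[l lm H]] := lpp_exit n m w0.
  have {}H : x + y <= (wsum w (Hsites k.+1) +
      lpp (w \o offset k.+1 1) (n - k) m)%:R :> R.
    by apply: le_trans (ltW Gxy) _; rewrite ler_nat.
  have [kk0|kk0] := leqP k0 k.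
    constructor 4; left; rewrite /D (big_cat_nat kk0 (leqW kn)) /=.
    rewrite [X in _ + X]big_nat_recl//=.
    have := le1_powR_exprn t1 H.
    have h1 : 0 <= \sum_(k0 <= i < k) t `^ (- (x + y)) *
       t ^+ (wsum w (Hsites i.+1) + lpp (w \o offset i.+1 1) (n - i) m).
      by apply: sumr_ge0 => i _; rewrite mulr_ge0 ?powR_ge0// exprn_ge0// ltW.
    have h2 : 0 <= \sum_(k <= i < n) t `^ (- (x + y)) *
       t ^+ (wsum w (Hsites i.+2) + lpp (w \o offset i.+2 1) (n - i.+1) m).
      by apply: sumr_ge0 => i _; rewrite mulr_ge0 ?powR_ge0// exprn_ge0// ltW.
    lra.
  constructor 2; apply: le1_powR_exprn => //.
  have h1 : (wsum w (Hsites k.+1))%:R <= (wsum w (Hsites k0))%:R :> R.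
    by rewrite ler_nat wsum_H_mono.
  (* An exit within the stretch: the path that follows lies in the bulk. *)
  have h2 : (lpp (w \o offset k.+1 1) (n - k) m)%:R <= x.
    apply: le_trans Lx; rewrite ler_nat.
    have := lpp_offset (w \o offset 1 1) k 0 (n - k) m.
    rewrite subnKC// add0n; apply: leq_trans.
  by move: H; rewrite natrD; lra.
have {}H : x + y <= (wsum w (Vsites l.+1) +
    lpp (w \o offset 1 l.+1) n (m - l))%:R :> R.
  by apply: le_trans (ltW Gxy) _; rewrite ler_nat.
have [ll0|ll0] := leqP l0 l.
  constructor 4; right; rewrite /E (big_cat_nat ll0 (leqW lm)) /=.
  rewrite [X in _ + X]big_nat_recl//=.
  have := le1_powR_exprn t1 H.
  have h1 : 0 <= \sum_(l0 <= i < l) t `^ (- (x + y)) *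
     t ^+ (wsum w (Vsites i.+1) + lpp (w \o offset 1 i.+1) n (m - i)).
    by apply: sumr_ge0 => i _; rewrite mulr_ge0 ?powR_ge0// exprn_ge0// ltW.
  have h2 : 0 <= \sum_(l <= i < m) t `^ (- (x + y)) *
     t ^+ (wsum w (Vsites i.+2) + lpp (w \o offset 1 i.+2) n (m - i.+1)).
    by apply: sumr_ge0 => i _; rewrite mulr_ge0 ?powR_ge0// exprn_ge0// ltW.
  lra.
constructor 3; apply: le1_powR_exprn => //.
have h1 : (wsum w (Vsites l.+1))%:R <= (wsum w (Vsites l0))%:R :> R.
  by rewrite ler_nat wsum_V_mono.
have h2 : (lpp (w \o offset 1 l.+1) n (m - l))%:R <= x.
  apply: le_trans Lx; rewrite ler_nat.
  have := lpp_offset (w \o offset 1 1) 0 l n (m - l).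
  rewrite subnKC// add0n; apply: leq_trans.
by move: H; rewrite natrD; lra.
Qed.

(** The expectation of [lower_tail_pointwise].  The boundary parameters p, q are
used with tilt 1 / t for the value with boundary and t for the boundary
stretches; the bulk after an exit through the bottom row, respectively through
the left column, is compared with the pair p1, q1, respectively p2, q2. *)
Lemma expect_lower_tail (R : realType) (p q t p1 q1 p2 q2 l x y : R) n m k0 l0 w :
  0 <= p < 1 -> 0 <= q < 1 -> 0 <= p1 < 1 -> 0 <= q1 < 1 ->
  0 <= p2 < 1 -> 0 <= q2 < 1 -> 0 <= l < 1 ->
  1 <= t -> p * t < 1 -> q * t < 1 -> p1 * t < 1 -> q1 * t < 1 ->
  p2 * t < 1 -> q2 * t < 1 ->
  p * q / t = l -> p1 * q1 * t = l -> p2 * q2 * t = l ->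
  (k0 <= n.+1)%N -> (l0 <= m.+1)%N ->
  (expect (rect n m) (fun=> l)
      (fun w => (((lpp w n m)%:R <= x)%R%:R : R)%:E) w <=
  (t `^ (x + y - (n.+1%:R * gmean (p / t) + m.+1%:R * gmean (q / t)))
  + (t `^ (k0%:R * gmean (p * t) - y)
  + (t `^ (l0%:R * gmean (q * t) - y)
  + (\sum_(k0 <= k < n.+1)
       t `^ (k.+1%:R * gmean (p * t) + ((n - k).+1%:R * gmean (p1 * t)
       + m.+1%:R * gmean (q1 * t)) - (x + y))
  + \sum_(l0 <= k < m.+1)
       t `^ (k.+1%:R * gmean (q * t) + (n.+1%:R * gmean (p2 * t)
       + (m - k).+1%:R * gmean (q2 * t)) - (x + y))))))%R%:E)%E.
Proof.
move=> hp hq hp1 hq1 hp2 hq2 hl t1 pt qt p1t q1t p2t q2t El El1 El2 k0n l0m.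
have t0 : 0 < t by exact: lt_le_trans t1.
have hb := bfield_itv hp hq hl.
have pt1 : p / t < 1.
  by rewrite ltr_pdivrMr// mul1r; apply: lt_le_trans t1; case/andP: hp.
have qt1 : q / t < 1.
  by rewrite ltr_pdivrMr// mul1r; apply: lt_le_trans t1; case/andP: hq.
pose Q (v : nat * nat -> nat) := (((lpp v n m)%:R <= x)%R%:R : R)%:E.
have Q0 v : (0 <= Q v)%E by rewrite lee_fin ler0n.
have Qr v v' : {in rect n m, v =1 v'} -> Q v = Q v'.
  move=> vv; rewrite /Q (@lpp_ext v v')// => a b an bm; apply: vv.
  by rewrite mem_rect an.
have -> : expect (rect n m) (fun=> l) Q w =
    expect (bsites n.+1 m.+1) (bfield p q l) (fun v => Q (v \o offset 1 1))
      (fun=> 0%N).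
  symmetry; apply: (expect_marginal _ _ (@offset_inj 1 1) hb Q0 (bsites_uniq _ _)
    (rect_uniq _ _)) => // y'.
  exact: offset11_bsites.
set s := bsites _ _; set fld := bfield _ _ _.
have us : uniq s by exact: bsites_uniq.
pose a1 (v : nat * nat -> nat) := (t^-1 ^+ lpp v n.+1 m.+1)%:E.
pose a2 (v : nat * nat -> nat) := (t ^+ wsum v (Hsites k0))%:E.
pose a3 (v : nat * nat -> nat) := (t ^+ wsum v (Vsites l0))%:E.
pose a4 k (v : nat * nat -> nat) :=
  (t ^+ (wsum v (Hsites k.+1) + lpp (v \o offset k.+1 1) (n - k) m))%:E.
pose a5 k (v : nat * nat -> nat) :=
  (t ^+ (wsum v (Vsites k.+1) + lpp (v \o offset 1 k.+1) n (m - k)))%:E.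
have p0 r : 0 <= t `^ r by exact: powR_ge0.
have P1 v : (0 <= a1 v)%E by rewrite lee_fin exprn_ge0// invr_ge0 ltW.
have P2 v : (0 <= a2 v)%E by rewrite lee_fin exprn_ge0// ltW.
have P3 v : (0 <= a3 v)%E by rewrite lee_fin exprn_ge0// ltW.
have P4 k v : (0 <= a4 k v)%E by rewrite lee_fin exprn_ge0// ltW.
have P5 k v : (0 <= a5 k v)%E by rewrite lee_fin exprn_ge0// ltW.
have PZ r a : (0 <= a -> 0 <= (t `^ r)%:E * a)%E.
  by move=> a0; rewrite mule_ge0// lee_fin.
pose b4 v := (\sum_(k0 <= k < n.+1) (t `^ (- (x + y)))%:E * a4 k v)%E.
pose b5 v := (\sum_(l0 <= k < m.+1) (t `^ (- (x + y)))%:E * a5 k v)%E.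
have B4 v : (0 <= b4 v)%E by apply: sume_ge0 => k _; exact: PZ.
have B5 v : (0 <= b5 v)%E by apply: sume_ge0 => k _; exact: PZ.
apply: (@le_trans _ _ (expect s fld (fun v => (t `^ (x + y))%:E * a1 v +
   ((t `^ (- y))%:E * a2 v + ((t `^ (- y))%:E * a3 v + (b4 v + b5 v))))%E
   (fun=> 0%N))).
  apply: le_expect => // v Hv.
  have v0 : v (0, 0)%N = 0%N by rewrite Hv// mem_bsites.
  have := @lower_tail_pointwise R t x y n m k0 l0 v t1 v0.
  rewrite -lee_fin !EFinD !EFinM -!sumEFin => /le_trans; apply.
  rewrite le_eqVlt; apply/orP; left; apply/eqP.
  by congr (_ + (_ + (_ + (_ + _))))%E; apply: eq_bigr => k _; rewrite EFinM.
have PP v : (0 <= b4 v + b5 v)%E by rewrite adde_ge0.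
have PPP v : (0 <= (t `^ (- y))%:E * a3 v + (b4 v + b5 v))%E.
  by rewrite adde_ge0// PZ.
rewrite (@expectD _ _ s fld (fun v => (t `^ (x + y))%:E * a1 v)%E)//; last 2 first.
- by move=> v; exact: PZ.
- by move=> v; rewrite !adde_ge0 ?PZ.
rewrite (@expectD _ _ s fld (fun v => (t `^ (- y))%:E * a2 v)%E)//; last first.
  by move=> v; exact: PZ.
rewrite (@expectD _ _ s fld (fun v => (t `^ (- y))%:E * a3 v)%E)//; last first.
  by move=> v; exact: PZ.
rewrite (@expectD _ _ s fld b4)// !expectZ//.
rewrite !expect_sum//; last 2 first.
- by move=> k v; exact: PZ.
- by move=> k v; exact: PZ.
rewrite !EFinD -!sumEFin.
apply: leeD; last (apply: leeD; last (apply: leeD; last apply: leeD)).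
- have := @expect_boundary R p q t^-1 n.+1 m.+1 hp hq.
  rewrite invr_gt0 El => /(_ t0 pt1 qt1) ->.
  rewrite -EFinM lee_fin.
  apply: (@le_trans _ _ (t `^ (x + y) *
     t^-1 `^ (n.+1%:R * gmean (p / t) + m.+1%:R * gmean (q / t)))).
    by apply: ler_wpM2l => //; rewrite mgf_exp2_le// invr_gt0.
  rewrite powRB ?(gt_eqF t0) ?implybT// -powR_inv1 ?(ltW t0)// -powRrM mulN1r.
  by rewrite powRN.
- rewrite powRB_comm// EFinM.
  apply: lee_wpmul2l; first by rewrite lee_fin.
  rewrite -[in leRHS](size_Hsites k0); apply: expect_string_le => //.
  + exact: Hsites_uniq.
  + exact: Hsites_sub.
  + by move=> z; rewrite mem_Hsites /fld /bfield => /and3P[-> _ _].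
- rewrite powRB_comm// EFinM.
  apply: lee_wpmul2l; first by rewrite lee_fin.
  rewrite -[in leRHS](size_Vsites l0); apply: expect_string_le => //.
  + exact: Vsites_uniq.
  + exact: Vsites_sub.
  + move=> z; rewrite mem_Vsites /fld /bfield => /and3P[-> y2 _].
    by rewrite (gtn_eqF y2).
- rewrite big_nat [leRHS]big_nat; apply: lee_sum => k /andP[_ kn].
  rewrite expectZ// powRB_comm// EFinM.
  apply: lee_wpmul2l; first by rewrite lee_fin.
  exact: expect_exitH_le.
- rewrite big_nat [leRHS]big_nat; apply: lee_sum => k /andP[_ kn].
  rewrite expectZ// powRB_comm// EFinM.
  apply: lee_wpmul2l; first by rewrite lee_fin.
  exact: expect_exitV_le.
Qed.

(** * Oriented paths and the recursion *)

(** The weight of an oriented path from (1, 1) is at most the recursive value at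
its endpoint. *)
Lemma oriented_path_le (w : nat * nat -> nat) (s : seq (nat * nat)) :
  path oriented_step (1, 1)%N s ->
  exists a b, last (1, 1)%N s = (a.+1, b.+1) /\
    (\sum_(y <- (1, 1)%N :: s) w y <= lpp (w \o offset 1 1) a b)%N.
Proof.
elim/last_ind: s => [_|s z IH].
  by exists 0%N, 0%N; split => //; rewrite big_seq1.
rewrite rcons_path last_rcons => /andP[/IH[a [b [-> H]]]].
rewrite -rcons_cons -cats1 big_cat big_seq1 /=.
case/orP => /eqP -> /=.
- exists a.+1, b; split => //; rewrite addnC.
  have -> : lpp (w \o offset 1 1) a.+1 b =
    (w (a.+2, b.+1) + (lpp (w \o offset 1 1) a.+1 b - w (a.+2, b.+1)))%N.
    by case: b {H} => [|b]; rewrite lppE offsetE !add1n; lia.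
  rewrite leq_add2l; apply: leq_trans H _.
  by case: b => [|b]; rewrite lppE offsetE !add1n; lia.
- exists a, b.+1; split => //; rewrite addnC.
  have -> : lpp (w \o offset 1 1) a b.+1 =
    (w (a.+1, b.+2) + (lpp (w \o offset 1 1) a b.+1 - w (a.+1, b.+2)))%N.
    by case: a {H} => [|a]; rewrite lppE offsetE !add1n; lia.
  rewrite leq_add2l; apply: leq_trans H _.
  by case: a => [|a]; rewrite lppE offsetE !add1n; lia.
Qed.

(** The recursive value is attained by an oriented path with the right number of
sites that stays in the rectangle. *)
Lemma oriented_path_ex (w : nat * nat -> nat) (a b : nat) :
  exists s : seq (nat * nat), [/\ path oriented_step (1, 1)%N s,
    last (1, 1)%N s = (a.+1, b.+1), size s = (a + b)%N,
    (forall y, y \in (1, 1)%N :: s -> (y.1 <= a.+1)%N && (y.2 <= b.+1)%N) &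
    (\sum_(y <- (1, 1)%N :: s) w y = lpp (w \o offset 1 1) a b)%N].
Proof.
have stepl a' b' : (exists s : seq (nat * nat), [/\ path oriented_step (1, 1)%N s,
    last (1, 1)%N s = (a'.+1, b'.+1), size s = (a' + b')%N,
    (forall y, y \in (1, 1)%N :: s -> (y.1 <= a'.+1)%N && (y.2 <= b'.+1)%N) &
    (\sum_(y <- (1, 1)%N :: s) w y = lpp (w \o offset 1 1) a' b')%N]) ->
    lpp (w \o offset 1 1) a'.+1 b' =
      (w (a'.+2, b'.+1) + lpp (w \o offset 1 1) a' b')%N ->
    exists s : seq (nat * nat), [/\ path oriented_step (1, 1)%N s,
    last (1, 1)%N s = (a'.+2, b'.+1), size s = (a'.+1 + b')%N,
    (forall y, y \in (1, 1)%N :: s -> (y.1 <= a'.+2)%N && (y.2 <= b'.+1)%N) &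
    (\sum_(y <- (1, 1)%N :: s) w y = lpp (w \o offset 1 1) a'.+1 b')%N].
  move=> [s [sp sl ss sy sw]] E; exists (rcons s (a'.+2, b'.+1)); split.
  - by rewrite rcons_path sp sl /oriented_step /= eqxx.
  - by rewrite last_rcons.
  - by rewrite size_rcons ss addSn.
  - move=> y; rewrite -rcons_cons mem_rcons inE => /orP[/eqP ->|/sy] /=; lia.
  - by rewrite -rcons_cons -cats1 big_cat big_seq1 sw E addnC.
have stepr a' b' : (exists s : seq (nat * nat), [/\ path oriented_step (1, 1)%N s,
    last (1, 1)%N s = (a'.+1, b'.+1), size s = (a' + b')%N,
    (forall y, y \in (1, 1)%N :: s -> (y.1 <= a'.+1)%N && (y.2 <= b'.+1)%N) &
    (\sum_(y <- (1, 1)%N :: s) w y = lpp (w \o offset 1 1) a' b')%N]) ->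
    lpp (w \o offset 1 1) a' b'.+1 =
      (w (a'.+1, b'.+2) + lpp (w \o offset 1 1) a' b')%N ->
    exists s : seq (nat * nat), [/\ path oriented_step (1, 1)%N s,
    last (1, 1)%N s = (a'.+1, b'.+2), size s = (a' + b'.+1)%N,
    (forall y, y \in (1, 1)%N :: s -> (y.1 <= a'.+1)%N && (y.2 <= b'.+2)%N) &
    (\sum_(y <- (1, 1)%N :: s) w y = lpp (w \o offset 1 1) a' b'.+1)%N].
  move=> [s [sp sl ss sy sw]] E; exists (rcons s (a'.+1, b'.+2)); split.
  - by rewrite rcons_path sp sl /oriented_step /= eqxx orbT.
  - by rewrite last_rcons.
  - by rewrite size_rcons ss addnS.
  - move=> y; rewrite -rcons_cons mem_rcons inE => /orP[/eqP ->|/sy] /=; lia.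
  - by rewrite -rcons_cons -cats1 big_cat big_seq1 sw E addnC.
elim: a b => [|a IHa]; elim=> [|b IHb].
- exists [::]; split => // [y|]; last by rewrite big_seq1.
  by rewrite inE => /eqP ->.
- by apply: stepr => //; rewrite lppE offsetE !add1n.
- by apply: stepl => //; rewrite lppE offsetE !add1n.
- have := lppSS (w \o offset 1 1) a b; rewrite offsetE !add1n.
  have [h|h] := leqP (lpp (w \o offset 1 1) a b.+1) (lpp (w \o offset 1 1) a.+1 b).
    by move=> E; exact: stepr.
  by move=> E; exact: stepl.
Qed.

Lemma last_passageE (w : nat * nat -> nat) (n m : nat) :
  last_passage w n.+1 m.+1 = lpp (w \o offset 1 1) n m.
Proof.
apply/eqP; rewrite eqn_leq; apply/andP; split.
  apply/bigmax_leqP => p; rewrite -(big_tuple _ _ p xpredT (fun u => w (site u))).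
  rewrite -(big_map (@site n.+1 m.+1) xpredT w).
  case: (map _ p) => [//|x s] /= /and3P[/eqP -> /(oriented_path_le w) H /eqP E].
  by move: H => [a [b [+ H]]]; rewrite E => -[-> ->].
have [s [sp sl ss sy <-]] := oriented_path_ex w n m.
pose f (y : nat * nat) : 'I_n.+2 * 'I_m.+2 := (inord y.1, inord y.2).
have sz : size (map f ((1, 1)%N :: s)) == (n.+1 + m.+1).-1.
  by apply/eqP; rewrite size_map /= ss; lia.
have E : map (@site n.+1 m.+1) (Tuple sz) = (1, 1)%N :: s.
  rewrite -map_comp -[RHS]map_id; apply/eq_in_map => y /sy /andP[y1 y2].
  by rewrite /= /site /f /= !inordK//; case: y {y1 y2}.
have := @leq_bigmax_cond _
  (fun p : (n.+1 + m.+1).-1.-tuple ('I_n.+2 * 'I_m.+2) =>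
    oriented_path (1, 1)%N (n.+1, m.+1) (map (@site n.+1 m.+1) p))
  (fun p => \sum_(j < (n.+1 + m.+1).-1) w (site (tnth p j)))%N (Tuple sz).
rewrite E /= sp sl !eqxx => /(_ isT); apply: leq_trans.
rewrite -(big_tuple _ _ (Tuple sz) xpredT (fun u => w (site u))).
by rewrite -(big_map (@site n.+1 m.+1) xpredT w) E.
Qed.

(** * Events that depend on finitely many weights *)

(** Under independence, the probability of an event that depends on the weights at
the sites of s is the iterated expectation of its indicator.  The induction
reveals the values at the sites of s one at a time: r1 is the list of revealed
sites and r2 that of the remaining ones. *)
Lemma config_event_law (R : realType) (d : measure_display) (T : measurableType d)
    (P : probability T R) (lambda : R) (xi : nat * nat -> {RV P >-> nat})
    (Q : (nat * nat -> nat) -> bool) (s : seq (nat * nat)) :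
  mutually_independent P quadrant xi ->
  (forall y, quadrant y -> geometric_law P lambda (xi y)) ->
  0 <= lambda < 1 -> uniq s -> [set` s] `<=` quadrant ->
  (forall w w', {in s, w =1 w'} -> Q w = Q w') ->
  let A := [set omega | Q (fun y => xi y omega)] in
  measurable A /\ P A = expect s (fun=> lambda) (fun w => (Q w)%:R%:E) (fun=> 0%N).
Proof.
move=> indep geom hl us sq Qs.
have mpre y k : measurable (xi y @^-1` [set k]).
  by rewrite -[X in measurable X]setTI; exact: measurable_funP.
pose C (r : seq (nat * nat)) (w : nat * nat -> nat) : set T :=
  \bigcap_(y in [set` r]) (xi y @^-1` [set w y]).
have mC r w : measurable (C r w).
  by apply: fin_bigcap_measurable => // y _; exact: mpre.
have PC r w : uniq r -> [set` r] `<=` quadrant ->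
    P (C r w) = (\prod_(y <- r) geo_weight lambda (w y))%:E.
  move=> ur rq; rewrite (indep r (fun y => [set w y])) //.
  rewrite -prodEFin big_seq [RHS]big_seq; apply: eq_bigr => y yr.
  by rewrite geom//; exact: rq.
suff H r2 : forall r1 w, perm_eq s (r1 ++ r2) ->
  measurable (C r1 w `&` [set omega | Q (fun y => xi y omega)]) /\
  P (C r1 w `&` [set omega | Q (fun y => xi y omega)]) =
  ((\prod_(y <- r1) geo_weight lambda (w y))%:E *
    expect r2 (fun=> lambda) (fun w => (Q w)%:R%:E) w)%E.
  have := H s [::] (fun=> 0%N) (perm_refl _).
  have -> : C [::] (fun=> 0%N) = setT by apply/seteqP; split.
  by rewrite setTI big_nil mul1e.
elim: r2 => [|y r2 IH] r1 w sr.
  rewrite cats0 in sr => /=.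
  have QE omega : C r1 w omega -> Q (fun y => xi y omega) = Q w.
    move=> Com; apply: Qs => y ys; apply: (Com y).
    by rewrite /= -(perm_mem sr).
  have ur1 : uniq r1 by rewrite -(perm_uniq sr).
  have r1q : [set` r1] `<=` quadrant.
    by move=> y /= yr; apply: sq; rewrite /= (perm_mem sr).
  case E : (Q w).
    have -> : C r1 w `&` [set omega | Q (fun y => xi y omega)] = C r1 w.
      by apply/seteqP; split=> [omega []//|omega Co]; split => //=; rewrite QE.
    by split => //; rewrite PC// mule1.
  have -> : C r1 w `&` [set omega | Q (fun y => xi y omega)] = set0.
    by apply/seteqP; split=> // omega [Co] /=; rewrite QE// E.
  by rewrite measure0 mule0.
have yr1 : y \notin r1.
  have : uniq (r1 ++ y :: r2) by rewrite -(perm_uniq sr).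
  by rewrite cat_uniq => /and3P[_ /norP[]].
pose B k := C (y :: r1) (upd w y k) `&` [set omega | Q (fun y => xi y omega)].
have sr' : perm_eq s ((y :: r1) ++ r2).
  by apply: perm_trans sr _; rewrite perm_catC /= perm_cons perm_catC.
have HB k := IH (y :: r1) (upd w y k) sr'.
have CE k : C (y :: r1) (upd w y k) = C r1 w `&` (xi y @^-1` [set k]).
  apply/seteqP; split=> omega.
    move=> H; split => [z zr /=|].
      have := H z; rewrite /= inE zr orbT => /(_ isT); rewrite upd_diff//.
      by apply: contraNneq yr1 => <-.
    by have := H y; rewrite /= mem_head upd_same => /(_ isT).
  move=> [H1 H2] z; rewrite /= inE; case: eqVneq => [->|zy] /=.
    by rewrite upd_same.
  by move=> zr; rewrite upd_diff//; exact: H1.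
have UB : C r1 w `&` [set omega | Q (fun y => xi y omega)] = \bigcup_k B k.
  apply/seteqP; split=> omega.
    by move=> [Co Qo]; exists (xi y omega) => //; split => //; rewrite CE.
  by move=> [k _ []]; rewrite CE => -[Co _] Qo.
have mB k : measurable (B k) by case: (HB k).
have mU : measurable (\bigcup_k B k) by exact: bigcup_measurable.
rewrite UB; split => //.
rewrite measure_semi_bigcup//; last first.
  move=> i j _ _ [omega [[+ _] [+ _]]]; rewrite !CE => -[_ /= <-] [_ /= <-] //.
rewrite /= /geo_mean -nneseriesZl; last first.
  move=> k _; rewrite mule_ge0 ?lee_fin ?geo_weight_ge0//.
  by apply: expect_ge0 => // v; rewrite lee_fin ler0n.
apply: eq_eseriesr => k _; rewrite muleA -EFinM.
have [_ ->] := HB k; congr (_%:E * _)%E.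
rewrite big_cons upd_same mulrC; congr (_ * _).
rewrite big_seq [RHS]big_seq; apply: eq_bigr => z zr.
by rewrite upd_diff//; apply: contraNneq yr1 => <-.
Qed.

(** * Rate function *)

Lemma ler_gmean (R : realType) (x y : R) : x <= y -> y < 1 -> gmean x <= gmean y.
Proof.
move=> xy y1; have x1 : x < 1 by exact: le_lt_trans y1.
rewrite /gmean ler_pdivrMr ?subr_gt0// mulrAC ler_pdivlMr ?subr_gt0//.
by move: xy; lra.
Qed.

Lemma gmean_div (R : realType) (l x : R) : 0 < x -> l < x ->
  gmean (l / x) = l / (x - l).
Proof.
by move=> x0 lx; rewrite /gmean; field; rewrite !gt_eqF// subr_gt0.
Qed.

(** At a critical pair a, l / a for the weights al and be, moving an amount al - e
of the first weight to a slightly larger parameter a', with the second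
parameter l / a', strictly lowers the total mean. *)
Lemma gmean_gap (R : realType) (al be l a e : R) :
  0 < l -> l < a -> a < 1 -> 0 < be ->
  al * (a - l) ^+ 2 = be * l * (1 - a) ^+ 2 -> 0 < e -> e <= al ->
  exists a' : R, [/\ a < a', a' < 1 &
    e * gmean a + (al - e) * gmean a' + be * gmean (l / a') <
    al * gmean a + be * gmean (l / a)].
Proof.
move=> l0 la a1 be0 crit e0 eal.
have al0 : 0 < al by exact: lt_le_trans eal.
pose u := a - l; pose v := 1 - a.
have u0 : 0 < u by rewrite subr_gt0.
have v0 : 0 < v by rewrite subr_gt0.
have uv0 : 0 < u + v by exact: addr_gt0.
have auv0 : 0 < al * (u + v) by exact: mulr_gt0.
have euv0 : 0 < e * u * v by apply: mulr_gt0 => //; exact: mulr_gt0.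
(* The gap has the sign of (u / v) (e u v - k al (u + v)) + e u k, and this k
   cancels the first term. *)
pose k := e * u * v / (al * (u + v)).
have k0 : 0 < k by exact: divr_gt0.
have kE : k * (al * (u + v)) = e * u * v by rewrite /k divfK// gt_eqF.
have kv : k < v.
  rewrite /k ltr_pdivrMr// mulrC ltr_pM2l//.
  apply: (@le_lt_trans _ _ (al * u)); first by rewrite ler_pM2r.
  by rewrite ltr_pM2l// ltrDl.
have a0 : 0 < a by exact: lt_trans la.
have lk : l < a + k by rewrite (lt_trans la)// ltrDl.
exists (a + k)%R; split; first by rewrite ltrDl.
  by move: kv; rewrite /v; lra.
rewrite (gmean_div a0 la) (gmean_div (addr_gt0 a0 k0) lk).
rewrite -subr_gt0.
have -> : al * gmean a + be * (l / (a - l)) -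
   (e * gmean a + (al - e) * gmean (a + k) + be * (l / (a + k - l))) =
   k / (v * (v - k) * u * (u + k)) *
   (be * l * v * (v - k) - (al - e) * u * (u + k)).
  rewrite /gmean /u /v; field.
  by move: kv u0 v0; rewrite /u /v => *; rewrite !gt_eqF//; lra.
have vk0 : 0 < v - k by rewrite subr_gt0.
have uk0 : 0 < u + k by exact: addr_gt0.
apply: mulr_gt0.
  by apply: divr_gt0 => //; do 3![apply: mulr_gt0 => //].
have -> : be * l * v * (v - k) - (al - e) * u * (u + k) =
  (be * l * v ^+ 2) * (1 - k / v) - (al - e) * u * (u + k).
  by field; rewrite gt_eqF.
rewrite -crit -/u.
have -> : al * u ^+ 2 * (1 - k / v) - (al - e) * u * (u + k) =
   (u / v) * (e * u * v - k * (al * (u + v))) + e * u * k.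
  by field; rewrite gt_eqF.
by rewrite kE subrr mulr0 add0r; apply: mulr_gt0 => //; exact: mulr_gt0.
Qed.

Lemma near_gmean (R : realType) (u : R -> R) (c th : R) :
  u t @[t --> 1^'+] --> c -> c < 1 -> 0 < th ->
  \forall t \near (1:R)^'+, u t < 1 /\ `|gmean c - gmean (u t)| < th.
Proof.
move=> uc c1 th0.
have h : gmean (u t) @[t --> 1^'+] --> gmean c.
  apply: cvgM => //; apply: cvgV; first by rewrite subr_eq0 gt_eqF.
  by apply: cvgB => //; exact: cvg_cst.
near=> t; split; near: t; first exact: (cvgr_lt _ uc _ c1).
exact: (cvgr_dist_lt _ _ h _ th0).
Unshelve. all: by end_near.
Qed.

(** Half of the exponential rate absorbs a linear factor. *)
Lemma linear_exp_decay (R : realType) (K ka : R) : 0 <= K -> 0 < ka ->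
  exists N0 : nat, forall N : nat, (N0 <= N)%N ->
    K * N%:R * expR (- (ka * N%:R)) <= expR (- (ka / 2 * N%:R)).
Proof.
move=> K0 ka0; exists (Num.truncn (8 * K / ka ^+ 2)).+1 => N NN.
have hN : 8 * K / ka ^+ 2 <= N%:R.
  by apply: (le_trans (ltW (truncnS_gt _))); rewrite ler_nat.
have -> : expR (- (ka / 2 * N%:R)) =
  expR (ka / 2 * N%:R) * expR (- (ka * N%:R)) by rewrite -expRD; congr expR; field.
rewrite ler_pM2r ?expR_gt0//.
have := @expR_ge1Dxn R (ka / 2 * N%:R) 1.
rewrite mulr_ge0 ?divr_ge0 ?(ltW ka0)// => /(_ isT).
apply: le_trans; apply: (@le_trans _ _ ((ka / 2 * N%:R) ^+ 2 / 2)); last first.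
  by rewrite (_ : 2`!%:R = 2) //; rewrite lerDr.
(* The quadratic term of the exponential series beats the linear factor. *)
have -> : (ka / 2 * N%:R) ^+ 2 / 2 = (ka ^+ 2 / 8 * N%:R) * N%:R by field.
apply: ler_wpM2r => //.
by move: hN; rewrite ler_pdivrMr ?exprn_gt0//; lra.
Qed.

(** The critical pair a = (l + r) / (1 + r), b = l (1 + r) / (l + r) with
r = sqrt (be l).  The two quadratic identities are the stationarity conditions
of a |-> gmean a + be * gmean (l / a), in terms of a and of b. *)
Lemma critical_parameters (R : realType) (l be : R) : 0 < l < 1 -> 0 < be ->
  exists a b : R, [/\ l < a < 1, l < b < 1, a * b = l,
    (a - l) ^+ 2 = be * l * (1 - a) ^+ 2 /\ be * (b - l) ^+ 2 = l * (1 - b) ^+ 2 &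
    gmean a + be * gmean b = (1 + Num.sqrt (be * l)) ^+ 2 / (1 - l) - 1].
Proof.
move=> /andP[l0 l1] be0; set r := Num.sqrt (be * l).
have bl0 : 0 < be * l by exact: mulr_gt0.
have r0 : 0 < r by rewrite sqrtr_gt0.
have r2 : r ^+ 2 = be * l by rewrite sqr_sqrtr// ltW.
have r10 : 0 < 1 + r by lra.
have lr0 : 0 < l + r by lra.
have l10 : 0 < 1 - l by lra.
have beE : be = r ^+ 2 / l by rewrite r2 mulfK// gt_eqF.
exists ((l + r) / (1 + r)), (l * (1 + r) / (l + r)); split.
- rewrite ltr_pdivlMr// ltr_pdivrMr//; apply/andP; split; last lra.
  by rewrite mulrDr mulr1 ltrD2l gtr_pMl.
- rewrite ltr_pdivlMr// ltr_pdivrMr//; apply/andP; split.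
    by rewrite ltr_pM2l//; lra.
  by rewrite mulrDr mulr1 mul1r ltrD2l gtr_pMl.
- by field; rewrite !gt_eqF.
- by rewrite beE; split; field; rewrite !gt_eqF.
- have h : l + r - l * (1 + r) != 0.
    by rewrite (_ : _ - _ = r * (1 - l)) ?gt_eqF ?mulr_gt0//; ring.
  by rewrite beE /gmean; field; rewrite h !gt_eqF.
Qed.

(** Upper tail in the discrete model, for any pair a b = l. *)
Lemma upper_tail_bound (R : realType) (l be de a b : R) :
  0 < l -> l < a < 1 -> l < b < 1 -> a * b = l -> 0 < be -> 0 < de ->
  exists2 c : R, 0 < c & forall (n m : nat) w, m.+1%:R <= be * n.+1%:R ->
    (expect (rect n m) (fun=> l) (fun w =>
      ((n.+1%:R * (gmean a + be * gmean b + de) <= (lpp w n m)%:R)%R%:R : R)%:E) w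
    <= (expR (- (c * n.+1%:R)))%:E)%E.
Proof.
move=> l0 /andP[la a1] /andP[lb b1] ab be0 de0.
have a0 : 0 < a by exact: lt_trans la.
have b0 : 0 < b by exact: lt_trans lb.
have cva : a * t @[t --> 1^'+] --> a.
  rewrite -[X in _ --> X]mulr1; apply: cvg_at_right_filter.
  by apply: cvgM; [exact: cvg_cst|exact: cvg_id].
have de2 : 0 < de / 2 by rewrite divr_gt0.
have : \forall t \near (1:R)^'+,
    1 < t /\ a * t < 1 /\ `|gmean a - gmean (a * t)| < de / 2.
  near=> t; split; near: t; first exact: nbhs_right_gt.
  exact: near_gmean.
move=> /filter_ex [t [t1 [at1 /ltr_distlCDr ht]]].
have t0 : 0 < t by exact: lt_trans t1.
(* With tilt t the pair is a t, b; the excess gmean (a t) - gmean a uses up half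
   of de. *)
exists (de / 2 * ln t); first by rewrite mulr_gt0// ln_gt0.
move=> n m w mn.
(* Boundary parameters a and b / t for the bulk parameter l and tilt t. *)
have lE : l = a * (b / t) * t by rewrite -ab -mulrA divfK// gt_eqF.
have bt : b / t * t < 1 by rewrite divfK// gt_eqF.
have hb : 0 <= b / t < 1.
  rewrite divr_ge0 ?(ltW b0) ?(ltW t0)//= ltr_pdivrMr// mul1r.
  exact: lt_trans t1.
have ha : 0 <= a < 1 by rewrite ltW.
have := @expect_upper_tail R a (b / t) t
  (n.+1%:R * (gmean a + be * gmean b + de)) n m w ha hb (ltW t1) at1 bt.
rewrite -lE => /le_trans; apply.
rewrite lee_fin divfK ?gt_eqF// /powR gt_eqF// ler_expR.
rewrite (_ : - (de / 2 * ln t * n.+1%:R) = - (de / 2) * n.+1%:R * ln t); last by ring.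
rewrite ler_pM2r ?ln_gt0//.
have B0 : 0 <= gmean b by rewrite gmean_ge0// ltW.
have h1 : m.+1%:R * gmean b <= be * n.+1%:R * gmean b by exact: ler_wpM2r.
have h2 : n.+1%:R * gmean (a * t) <= n.+1%:R * (gmean a + de / 2).
  by apply: ler_wpM2l => //; exact: ltW.
by move: h1 h2; set x := n.+1%:R; set y := m.+1%:R; lra.
Unshelve. all: by end_near.
Qed.

(** * The lower tail with explicit constants *)

Lemma sum_nat_le (R : realType) (f : nat -> R) (Z : R) i j :
  (forall k, (i <= k < j)%N -> f k <= Z) -> 0 <= Z ->
  \sum_(i <= k < j) f k <= j%:R * Z.
Proof.
move=> fZ Z0; apply: (@le_trans _ _ (\sum_(i <= k < j) Z)).
  by rewrite big_nat [leRHS]big_nat; apply: ler_sum.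
by rewrite sumr_const_nat -[leLHS]mulr_natl ler_wpM2r// ler_nat leq_subr.
Qed.

(** A tilt t > 1 so close to 1 that no mean in [expect_lower_tail] is worse than
its limit by more than th. *)
Lemma lower_tail_tilt (R : realType) (l a b a' b' th : R) :
  0 < l -> l < a < 1 -> l < b < 1 -> a < a' < 1 -> b < b' < 1 -> 0 < th ->
  exists t : R, [/\ 1 < t,
    a * t * t <= a' /\ gmean (a * t * t) <= gmean a + th,
    b * t <= b' /\ gmean (b * t) <= gmean b + th,
    l / a' * t < 1 /\ gmean (l / a' * t) <= gmean (l / a') + th &
    (l / b' * t < 1 /\ gmean (l / b' * t) <= gmean (l / b') + th) /\
    gmean b - th <= gmean (b / t)].
Proof.
move=> l0 /andP[la a1] /andP[lb b1] /andP[aa' a'1] /andP[bb' b'1] th0.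
have cvm (c : R) : c * t @[t --> 1^'+] --> c.
  rewrite -[X in _ --> X]mulr1; apply: cvg_at_right_filter.
  by apply: cvgM; [exact: cvg_cst|exact: cvg_id].
have cvm2 : a * t * t @[t --> 1^'+] --> a.
  rewrite -[X in _ --> X]mulr1; apply: cvgM => //.
  by apply: cvg_at_right_filter; exact: cvg_id.
have cvd : b / t @[t --> 1^'+] --> b.
  rewrite -[X in _ --> X]divr1.
  apply: cvg_at_right_filter; apply: cvgM; first exact: cvg_cst.
  by apply: cvgV; [exact: oner_neq0|exact: cvg_id].
have la' : l / a' < 1 by rewrite ltr_pdivrMr ?mul1r; lra.
have lb' : l / b' < 1 by rewrite ltr_pdivrMr ?mul1r; lra.
have : \forall t \near (1:R)^'+, 1 < t /\ (a * t * t < a' /\ (b * t < b' /\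
  ((a * t * t < 1 /\ `|gmean a - gmean (a * t * t)| < th) /\
   ((b * t < 1 /\ `|gmean b - gmean (b * t)| < th) /\
   ((l / a' * t < 1 /\ `|gmean (l / a') - gmean (l / a' * t)| < th) /\
   ((l / b' * t < 1 /\ `|gmean (l / b') - gmean (l / b' * t)| < th) /\
    (b / t < 1 /\ `|gmean b - gmean (b / t)| < th))))))).
  near=> t; (split; [|split; [|split; [|split; [|split; [|split; [|split]]]]]]);
    near: t.
  - exact: nbhs_right_gt.
  - exact: (cvgr_lt _ cvm2 _ aa').
  - exact: (cvgr_lt _ (cvm b) _ bb').
  - exact: near_gmean.
  - exact: near_gmean.
  - exact: near_gmean.
  - exact: near_gmean.
  - exact: near_gmean.
move=> /filter_ex [t [t1 [h1 [h2 [[_ /ltr_distlCDr h3] [[_ /ltr_distlCDr h4]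
  [[h5 /ltr_distlCDr h5'] [[h6 /ltr_distlCDr h6'] [_ h7]]]]]]]]].
exists t; split => //.
- by split; exact: ltW.
- by split; exact: ltW.
- by split => //; exact: ltW.
- split; first by split => //; exact: ltW.
  by move: h7; rewrite ltr_norml => /andP[_]; lra.
Unshelve. all: by end_near.
Qed.

(** The exponent of the value with boundary. *)
Lemma origin_exponent (R : realType) (N M A B Bt be th eta : R) :
  0 <= N -> 0 <= be -> be * N <= M + 1 -> 0 <= Bt -> Bt <= B -> B - th <= Bt ->
  be * th <= eta / 2 ->
  N * (A + be * B - eta) - (N * A + M * Bt) <= B - eta / 2 * N.
Proof.
move=> N0 be0 beM Bt0 BtB Bth bth.
have i1 : N * (be * (B - th)) <= N * (be * Bt).
  by rewrite ler_wpM2l// ler_wpM2l.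
have i2 : (be * N - 1) * Bt <= M * Bt by apply: ler_wpM2r => //; lra.
have i3 : N * (be * th) <= N * (eta / 2) by rewrite ler_wpM2l.
lra.
Qed.

(** The exponent of an initial boundary stretch of length K <= e N. *)
Lemma string_exponent (R : realType) (N K A s e th eta de : R) :
  0 <= N -> 0 <= de -> 0 <= K -> 0 <= s -> K <= e * N -> s <= A + th ->
  e * (A + th) <= de / 4 -> eta <= de / 8 ->
  K * s - N * (de - eta) <= - (eta / 2 * N).
Proof.
move=> N0 de0 K0 s0 KN sA eA etade.
have i1 : K * s <= e * N * (A + th) by apply: ler_pM.
have i2 : N * (e * (A + th)) <= N * (de / 4) by rewrite ler_wpM2l.
have i3 : N * eta <= N * (de / 8) by rewrite ler_wpM2l.
have i4 : 0 <= N * de by rewrite mulr_ge0.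
lra.
Qed.

(** The exponent of an exit at distance K >= e N.  The gap beats the errors th
coming from the tilt. *)
Lemma exit_exponent (R : realType) (N K L L' A B s f h e al be th eta g : R) :
  0 <= N -> 0 <= e -> 0 <= be -> 0 <= f -> 0 <= h ->
  e * N <= K -> L <= al * N -> L' <= be * N ->
  s <= f -> s <= A + th -> h <= B + th ->
  eta * 2 <= g - (e * A + (al - e) * f + be * B) ->
  (e + be) * th <= eta / 2 ->
  K * s + ((L - K + 1) * f + L' * h) - N * (g - eta) <= f - eta / 2 * N.
Proof.
move=> N0 e0 be0 f0 h0 eK LN L'N sf sA hB gap eth.
have i1 : e * N * (f - s) <= K * (f - s) by rewrite ler_wpM2r ?subr_ge0.
have i2 : L' * h <= be * N * h by rewrite ler_wpM2r.
have i3 : N * (e * s) <= N * (e * (A + th)).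
  by rewrite ler_wpM2l// ler_wpM2l.
have i4 : N * (be * h) <= N * (be * (B + th)).
  by rewrite ler_wpM2l// ler_wpM2l.
have i5 : N * (e * (A + th) + (al - e) * f + be * (B + th)) <=
    N * (g - eta * 2 + eta / 2) by rewrite ler_wpM2l//; lra.
have i6 : L * f <= al * N * f by rewrite ler_wpM2r.
lra.
Qed.

(** Lower tail in the discrete model, for the critical pair. *)
Lemma lower_tail_bound (R : realType) (l be de a b : R) :
  0 < l -> l < a < 1 -> l < b < 1 -> a * b = l ->
  (a - l) ^+ 2 = be * l * (1 - a) ^+ 2 ->
  be * (b - l) ^+ 2 = l * (1 - b) ^+ 2 ->
  0 < be -> 0 < de ->
  exists (c : R) (N0 : nat), 0 < c /\ forall (n m : nat) w, (N0 <= n.+1)%N ->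
    m.+1%:R <= be * n.+1%:R < m.+2%:R ->
    (expect (rect n m) (fun=> l) (fun w =>
      (((lpp w n m)%:R <= n.+1%:R * (gmean a + be * gmean b - de))%R%:R : R)%:E) w
    <= (expR (- (c * n.+1%:R)))%:E)%E.
Proof.
move=> l0 hla hlb ab crit1 crit2 be0 de0.
have /andP[la a1] := hla; have /andP[lb b1] := hlb.
have a0 : 0 < a by exact: lt_trans la.
have b0 : 0 < b by exact: lt_trans lb.
have lab : l / a = b by rewrite -ab mulrAC mulfV ?mul1r// gt_eqF.
have lba : l / b = a by rewrite -ab mulfK// gt_eqF.
set A := gmean a; set B := gmean b; set g := A + be * B.
have A0 : 0 <= A by rewrite gmean_ge0// ltW.
have B0 : 0 <= B by rewrite gmean_ge0// ltW.
(* The length e N of the initial stretches: short enough for their mean weight to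
   be at most de / 8 per unit of N. *)
pose e := Num.min (Num.min 1 be) (de / (8 * (A + B + 1))).
have AB1 : 0 < 8 * (A + B + 1) by lra.
have e0 : 0 < e by rewrite !lt_min ltr01 be0 divr_gt0.
have e1 : e <= 1 by rewrite !ge_min lexx.
have ebe : e <= be by rewrite !ge_min lexx orbT.
have eAB : e * (8 * (A + B + 1)) <= de.
  by rewrite -ler_pdivlMr// !ge_min lexx orbT.
(* Comparison parameters for the exits through the bottom row and the left
   column. *)
have [|a' [aa' a'1 gap1]] := gmean_gap l0 la a1 be0 _ e0 e1.
  by rewrite mul1r.
have [|b' [bb' b'1 gap2]] := gmean_gap l0 lb b1 ltr01 _ e0 ebe.
  by rewrite mul1r.
rewrite lab -/A -/B mul1r -/g in gap1.
rewrite lba -/A -/B !mul1r (addrC _ A) -/g in gap2.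
set A' := gmean a' in gap1; set B1 := gmean (l / a') in gap1.
set B' := gmean b' in gap2; set A1 := gmean (l / b') in gap2.
(* Typical values with boundary exceed N (g - eta), and exits beyond the stretches
   stay below by the gap. *)
pose eta := Num.min (de / 8) (Num.min
  (g - (e * A + (1 - e) * A' + be * B1)) (g - (e * B + (be - e) * B' + A1)) / 2).
have eta0 : 0 < eta by rewrite lt_min !divr_gt0// lt_min !subr_gt0 gap1 gap2.
have etade : eta <= de / 8 by rewrite ge_min lexx.
have etag : eta * 2 <= Num.min
  (g - (e * A + (1 - e) * A' + be * B1)) (g - (e * B + (be - e) * B' + A1)).
  by rewrite -ler_pdivlMr// ge_min lexx orbT.
have etag1 : eta * 2 <= g - (e * A + (1 - e) * A' + be * B1).
  by apply: le_trans etag _; rewrite ge_min lexx.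
have etag2 : eta * 2 <= g - (e * B + (be - e) * B' + A1).
  by apply: le_trans etag _; rewrite ge_min lexx orbT.
(* The admissible error in each mean: at most 2 + be such errors add up to
   eta / 2. *)
pose th := eta / (2 * (2 + be)).
have th0 : 0 < th by rewrite divr_gt0// mulr_gt0// addr_gt0.
have thE : th * (2 * (2 + be)) = eta by rewrite divfK// gt_eqF// mulr_gt0// addr_gt0.
have haa' : a < a' < 1 by rewrite aa'.
have hbb' : b < b' < 1 by rewrite bb'.
have [t [t1 [at2 hA] [bt hB] [la't hB1] [[lb't hA1] hB0]]] :=
  lower_tail_tilt l0 hla hlb haa' hbb' th0.
rewrite -/A in hA; rewrite -/B in hB hB0; rewrite -/B1 in hB1; rewrite -/A1 in hA1.
set Aat := gmean (a * t * t) in hA; set Bt := gmean (b * t) in hB.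
set B1t := gmean (l / a' * t) in hB1; set A1t := gmean (l / b' * t) in hA1.
set Bit := gmean (b / t) in hB0.
have t0 : 0 < t by exact: lt_trans t1.
have lnt0 : 0 < ln t by exact: ln_gt0.
(* C bounds the rounding errors in the exponents. *)
pose C := B + A' + B'.
pose K := (4 + be) * t `^ C; pose ka := eta / 2 * ln t.
have K0 : 0 <= K by rewrite mulr_ge0 ?powR_ge0// addr_ge0// ltW.
have ka0 : 0 < ka by rewrite mulr_gt0// divr_gt0.
have [N0 HN0] := linear_exp_decay K0 ka0.
exists (ka / 2), N0; split; first by rewrite divr_gt0.
move=> n m w nN0 /andP[mbe bem].
pose k0 := Num.truncn (e * n.+1%:R).
have en0 : 0 <= e * n.+1%:R by rewrite mulr_ge0// ltW.
have k0e : k0%:R <= e * n.+1%:R by rewrite truncn_le.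
have ek0 : e * n.+1%:R < k0.+1%:R by exact: truncnS_gt.
have k0n : (k0 <= n.+1)%N.
  rewrite -(ler_nat R); apply: le_trans k0e _.
  by rewrite -[leRHS]mul1r ler_wpM2r.
have k0m : (k0 <= m.+1)%N.
  rewrite -ltnS -(ltr_nat R); apply: le_lt_trans bem.
  by apply: le_trans k0e _; rewrite ler_wpM2r.
have a'0 : 0 < a' by exact: lt_trans aa'.
have b'0 : 0 < b' by exact: lt_trans bb'.
have A'0 : 0 <= A' by rewrite gmean_ge0// ltW.
have B'0 : 0 <= B' by rewrite gmean_ge0// ltW.
have la'1 : l / a' < 1 by rewrite ltr_pdivrMr ?mul1r// (lt_trans la).
have lb'1 : l / b' < 1 by rewrite ltr_pdivrMr ?mul1r// (lt_trans lb).
have div0 x y : 0 < x -> 0 < y -> 0 <= x / y :> R.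
  by move=> x0 y0; rewrite divr_ge0// ltW.
have tdiv x : 0 < x -> x < 1 -> x / t < 1.
  by move=> x0 x1; rewrite ltr_pdivrMr// mul1r (lt_trans x1).
have att1 : a * t * t < 1 by exact: le_lt_trans a'1.
have at1 : a * t < 1.
  by apply: le_lt_trans att1; rewrite ler_peMr ?(ltW t1)// mulr_ge0// ltW.
have bt1 : b * t < 1 by exact: le_lt_trans b'1.
have a't : a' / t * t = a' by rewrite divfK// gt_eqF.
have b't : b' / t * t = b' by rewrite divfK// gt_eqF.
have att : a * t / t = a by rewrite mulfK// gt_eqF.
(* The thresholds of [lower_tail_pointwise], with x + y = N (g - eta). *)
pose x := n.+1%:R * (g - de); pose y := n.+1%:R * (de - eta).
(* The boundary parameters are a t and b: their product divided by the tilt t is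
   the bulk parameter l. *)
have := @expect_lower_tail R (a * t) b t (a' / t) (l / a') (l / b') (b' / t) l x y
  n m k0 k0 w.
rewrite att a't b't -/A -/Aat -/Bt -/A' -/B1t -/A1t -/B' -/Bit.
have h0 : 0 <= a * t < 1 by rewrite at1 mulr_ge0// ltW.
have h1 : 0 <= b < 1 by rewrite b1 ltW.
have h2 : 0 <= a' / t < 1 by rewrite div0// tdiv.
have h3 : 0 <= l / a' < 1 by rewrite div0.
have h4 : 0 <= l / b' < 1 by rewrite div0.
have h5 : 0 <= b' / t < 1 by rewrite div0// tdiv.
have h6 : 0 <= l < 1 by rewrite ltW//= (lt_trans la).
have h7 : a * t * b / t = l by rewrite mulrAC mulfK ?gt_eqF.
have h8 : a' / t * (l / a') * t = l by field; rewrite !gt_eqF.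
have h9 : l / b' * (b' / t) * t = l by field; rewrite !gt_eqF.
move=> /(_ h0 h1 h2 h3 h4 h5 h6 (ltW t1) att1 bt1 a'1 la't lb't b'1 h7 h8 h9
  k0n k0m) /le_trans; apply.
rewrite lee_fin.
set N : R := n.+1%:R; set M : R := m.+1%:R.
have N1 : 1 <= N by rewrite /N ler1n.
have N0' : 0 <= N by exact: le_trans N1.
have mbe' : M <= be * N by [].
have bem' : be * N < M + 1 by rewrite /M natr1.
have k0e' : k0%:R <= e * N by [].
have ek0' k : (k0 <= k)%N -> e * N <= k.+1%:R.
  by move=> k0k; apply: (le_trans (ltW ek0)); rewrite ler_nat.
have Bit0 : Bit <= B.
  apply: ler_gmean => //; rewrite ler_pdivrMr// ler_peMr// ltW//.
have AA' : Aat <= A' by exact: ler_gmean.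
have BB' : Bt <= B' by exact: ler_gmean.
have Aat0 : 0 <= Aat by rewrite gmean_ge0// att1 !mulr_ge0// ltW.
have Bt0 : 0 <= Bt by rewrite gmean_ge0// bt1 mulr_ge0// ltW.
have B1t0 : 0 <= B1t by rewrite gmean_ge0// la't mulr_ge0 ?div0// ltW.
have A1t0 : 0 <= A1t by rewrite gmean_ge0// lb't mulr_ge0 ?div0// ltW.
have xyE : x + y = N * (g - eta) by rewrite /x /y /N; ring.
have key z : z <= C - eta / 2 * N -> t `^ z <= t `^ (C - eta / 2 * N).
  by move=> zC; rewrite ler_powR// ltW.
set Z := t `^ (C - eta / 2 * N) in key.
have Z0 : 0 <= Z by exact: powR_ge0.
have eth : e * th <= th by rewrite -[leRHS]mul1r ler_wpM2r// ltW.
have bth : 0 <= be * th by rewrite mulr_ge0// ltW.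
have th2 : (2 + be) * th = eta / 2 by rewrite -thE; clear; field.
have bth2 : be * th <= eta / 2 by move: th2 th0; clear; lra.
have ebth : (e + be) * th <= eta / 2 by move: th2 eth th0; clear; lra.
have e1th : (e + 1) * th <= eta / 2 by move: th2 eth bth; clear; lra.
have eA0 : 0 <= e * A by rewrite mulr_ge0// ltW.
have eB0 : 0 <= e * B by rewrite mulr_ge0// ltW.
have thde : th <= de / 8 by move: th2 bth eta0 etade; clear; lra.
have eAth : e * (A + th) <= de / 4.
  by move: eAB eth thde eB0 e0; clear; lra.
have eBth : e * (B + th) <= de / 4.
  by move: eAB eth thde eA0 e0; clear; lra.
have Bit00 : 0 <= Bit by rewrite gmean_ge0// div0//= tdiv.
have be0' := ltW be0; have e0' := ltW e0; have de0' := ltW de0.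
have E1 : t `^ (x + y - (N * A + M * Bit)) <= Z.
  apply: key; rewrite xyE.
  have := origin_exponent A N0' be0' (ltW bem') Bit00 Bit0 hB0 bth2.
  by move/le_trans; apply; rewrite lerD2r /C -addrA lerDl addr_ge0.
have C0 : 0 <= C by rewrite !addr_ge0.
have E2 : t `^ (k0%:R * Aat - y) <= Z.
  apply: key; rewrite /y -/N.
  have := string_exponent N0' de0' (ler0n _ k0) Aat0 k0e' hA eAth etade.
  by move/le_trans; apply; rewrite lerDr.
have E3 : t `^ (k0%:R * Bt - y) <= Z.
  apply: key; rewrite /y -/N.
  have := string_exponent N0' de0' (ler0n _ k0) Bt0 k0e' hB eBth etade.
  by move/le_trans; apply; rewrite lerDr.
have E4 k : (k0 <= k < n.+1)%N ->
    t `^ (k.+1%:R * Aat + ((n - k).+1%:R * A' + M * B1t) - (x + y)) <= Z.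
  move=> /andP[k0k kn]; apply: key; rewrite xyE.
  have -> : (n - k).+1%:R = N - k.+1%:R + 1 :> R.
    by rewrite /N -natrB// subSS natr1.
  have N1N : N <= 1 * N by rewrite mul1r.
  have := exit_exponent N0' e0' be0' A'0 B1t0 (ek0' k k0k) N1N mbe' AA' hA hB1
    etag1 ebth.
  by move/le_trans; apply; rewrite lerD2r /C addrAC lerDr addr_ge0.
have E5 k : (k0 <= k < m.+1)%N ->
    t `^ (k.+1%:R * Bt + (N * A1t + (m - k).+1%:R * B') - (x + y)) <= Z.
  move=> /andP[k0k kn]; apply: key; rewrite xyE.
  have -> : (m - k).+1%:R = M - k.+1%:R + 1 :> R.
    by rewrite /M -natrB// subSS natr1.
  have N1N : N <= 1 * N by rewrite mul1r.
  have etag2' : eta * 2 <= g - (e * B + (be - e) * B' + 1 * A1) by rewrite mul1r.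
  have := exit_exponent N0' e0' ler01 B'0 A1t0 (ek0' k k0k) mbe' N1N BB' hB hA1
    etag2' e1th.
  rewrite (addrC (_ * B')) => /le_trans; apply.
  by rewrite lerD2r /C lerDr addr_ge0.
have S4 := sum_nat_le E4 Z0; have S5 := sum_nat_le E5 Z0.
apply: le_trans (HN0 _ nN0).
have ZE : Z = t `^ C * expR (- (ka * N)).
  rewrite /Z powRD; last by rewrite (gt_eqF t0) implybT.
  congr (_ * _); rewrite /powR gt_eqF// /ka; congr expR; ring.
rewrite -/N /K (_ : (4 + be) * t `^ C * N * expR (- (ka * N)) =
  (4 + be) * N * Z); last by rewrite ZE; ring.
have i1 : M * Z <= be * N * Z by rewrite ler_wpM2r.
have i2 : 1 * Z <= N * Z by rewrite ler_wpM2r.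
rewrite -/N in S4; rewrite -/M in S5.
by move: E1 E2 E3 S4 S5 i1 i2; clear; lra.
Qed.

(** * Conclusion *)

Lemma summable_expR (R : realType) (c : R) : 0 < c ->
  (\sum_(k <oo) (expR (- (c * k%:R)))%:E < +oo)%E.
Proof.
move=> c0; set q := expR (- c).
have hq : 0 <= q < 1 by rewrite expR_ge0 expR_lt1 oppr_lt0.
have q1 : 1 - q != 0 by rewrite subr_eq0 gt_eqF//; case/andP: hq.
have -> : (\sum_(k <oo) (expR (- (c * k%:R)))%:E =
    (1 - q)^-1%:E * geo_mean q (fun=> 1))%E.
  rewrite -nneseriesZl; last by move=> k _; rewrite mule1 lee_fin geo_weight_ge0.
  apply: eq_eseriesr => k _; rewrite mule1 -EFinM /geo_weight mulKf// /q.
  by rewrite -expRM_natr mulNr.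
by rewrite geo_mean_cst// mule1 ltry.
Qed.

(** Almost sure convergence from summable tails. *)
Lemma ae_cvg_exp_tail (R : realType) (d : measure_display) (T : measurableType d)
    (P : probability T R) (X : nat -> T -> R) (g : R) :
  (forall de, 0 < de -> exists (c : R) (N0 : nat), 0 < c /\
     forall N, (N0 <= N)%N -> measurable [set w | de < `|X N w - g|] /\
       (P [set w | (de < `|X N w - g|)%R] <= (expR (- (c * N%:R)))%:E)%E) ->
  {ae P, forall w, X N w @[N --> \oo] --> g}.
Proof.
move=> H.
have pos (j : nat) : 0 < j.+1%:R^-1 :> R by rewrite invr_gt0.
pose c j := projT1 (cid (H _ (pos j))).
pose N0 j := projT1 (cid (projT2 (cid (H _ (pos j))))).
have HN j : 0 < c j /\ forall N, (N0 j <= N)%N ->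
    measurable [set w | j.+1%:R^-1 < `|X N w - g|] /\
    (P [set w | (j.+1%:R^-1 < `|X N w - g|)%R] <= (expR (- (c j * N%:R)))%:E)%E.
  exact: (projT2 (cid (projT2 (cid (H _ (pos j)))))).
(* Below the threshold the events need not be measurable and are dropped. *)
pose F j N : set T := if (N0 j <= N)%N then [set w | j.+1%:R^-1 < `|X N w - g|]
   else set0.
have mF j N : measurable (F j N).
  by rewrite /F; case: ifP => // /(HN j).2[].
have F0 j : P (lim_sup_set (F j)) = 0%E.
  apply: lim_sup_set_cvg0 => //; have [c0 _] := HN j.
  apply: le_lt_trans (summable_expR c0).
  apply: lee_nneseries => // N _; rewrite /F; case: ifP => [/(HN j).2[]//|_].
  by rewrite measure0 lee_fin expR_ge0.
apply: (@negligibleS _ _ _ _ (\bigcup_j lim_sup_set (F j))); last first.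
  apply: negligible_bigcup => j; exists (lim_sup_set (F j)).
  split; [|exact: F0|by []].
  by apply: bigcap_measurable => // k _; exact: bigcup_measurable.
move=> w /= Hw; apply: contrapT => nw; apply: Hw.
apply/cvgrPdist_le => e e0.
have [j je] : exists j : nat, j.+1%:R^-1 <= e.
  exists (Num.truncn e^-1); rewrite invf_ple ?posrE//.
  exact/ltW/truncnS_gt.
have [n Hn] : exists n, forall N, (n <= N)%N -> ~ F j N w.
  apply: contrapT => nn; apply: nw; exists j => // n _.
  apply: contrapT => nF; apply: nn; exists n => N nN FN; apply: nF.
  by exists N.
near=> N; rewrite distrC; apply: le_trans je.
have nN : (maxn n (N0 j) <= N)%N by near: N; exact: nbhs_infty_ge.
have := Hn N (leq_trans (leq_maxl _ _) nN).
rewrite /F (leq_trans (leq_maxr _ _) nN) /= => /negP.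
by rewrite -leNgt.
Unshelve. all: by end_near.
Qed.

(** The law of the last passage value, as an iterated expectation. *)
Lemma last_passage_law (R : realType) (d : measure_display)
    (T : measurableType d) (P : probability T R) (lambda : R)
    (xi : nat * nat -> {RV P >-> nat}) (Q : nat -> bool) (n m : nat) :
  mutually_independent P quadrant xi ->
  (forall y, quadrant y -> geometric_law P lambda (xi y)) -> 0 <= lambda < 1 ->
  let A := [set omega |
    Q (last_passage (fun y => xi y omega) n.+1 m.+1)] in
  measurable A /\
  P A = expect (rect n m) (fun=> lambda) (fun w => (Q (lpp w n m))%:R%:E)
          (fun=> 0%N).
Proof.
move=> indep geom hl A.
pose Q' (w : nat * nat -> nat) := Q (lpp (w \o offset 1 1) n m).
have us : uniq (map (offset 1 1) (rect n m)).
  by rewrite map_inj_uniq ?rect_uniq//; exact: offset_inj.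
have sq : [set` map (offset 1 1) (rect n m)] `<=` quadrant.
  move=> y ys; have /mapP[z _ ->] : y \in map (offset 1 1) (rect n m) by exact: ys.
  by [].
have Q's w w' : {in map (offset 1 1) (rect n m), w =1 w'} -> Q' w = Q' w'.
  move=> ww; congr Q; apply: lpp_ext => a b an bm; apply: ww.
  by apply: map_f; rewrite mem_rect an.
have [mA PA] := config_event_law indep geom hl us sq Q's.
have AE : A = [set omega | Q' (fun y => xi y omega)].
  by rewrite /A /Q'; apply/seteqP; split=> w /=; rewrite last_passageE.
rewrite AE; split => //; rewrite PA.
exact: (@expect_map _ _ _ (offset 1 1) (rect n m) (fun=> lambda)
  (fun w => (Q (lpp w n m))%:R%:E) (fun=> 0%N) (@offset_inj 1 1)).
Qed.

(** The exponential bound on two-sided deviations, with the measurability of the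
events. *)
Lemma last_passage_deviation (R : realType) (d : measure_display)
    (T : measurableType d) (P : probability T R) (lambda beta : R)
    (xi : nat * nat -> {RV P >-> nat}) (de : R) :
  0 < lambda < 1 -> 0 < beta -> mutually_independent P quadrant xi ->
  (forall y, quadrant y -> geometric_law P lambda (xi y)) -> 0 < de ->
  let A N := [set omega | de < `| N%:R^-1 *
     (last_passage (fun y => xi y omega) N (Num.truncn (beta * N%:R)))%:R -
     ((1 + Num.sqrt (beta * lambda)) ^+ 2 / (1 - lambda) - 1) |] in
  exists (c : R) (N0 : nat), 0 < c /\ forall N, (N0 <= N)%N ->
    measurable (A N) /\ (P (A N) <= (expR (- (c * N%:R)))%:E)%E.
Proof.
move=> hl be0 indep geom de0 A.
have [a [b [ha hb ab [crit1 crit2] gE]]] := critical_parameters hl be0.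
have /andP[l0 l1] := hl.
have [c1 c10 Hup] := upper_tail_bound l0 ha hb ab be0 de0.
have [c2 [N2 [c20 Hlo]]] := lower_tail_bound l0 ha hb ab crit1 crit2 be0 de0.
pose g := (1 + Num.sqrt (beta * lambda)) ^+ 2 / (1 - lambda) - 1.
rewrite -/g in gE.
pose c := Num.min c1 c2.
have c0 : 0 < c by rewrite lt_min c10.
have [N3 H3] := linear_exp_decay (ler0n R 2) c0.
exists (c / 2), (maxn N2 (maxn N3 (Num.truncn beta^-1).+1)).
split; first by rewrite divr_gt0.
case=> [|n]; first by rewrite !geq_max ltn0 !andbF.
rewrite !geq_max => /and3P[NN2 NN3 NN].
have M1 : 1 <= beta * n.+1%:R.
  rewrite mulrC -ler_pdivrMr// mul1r; apply: (le_trans (ltW (truncnS_gt _))).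
  by rewrite ler_nat.
case EM : (Num.truncn (beta * n.+1%:R)) => [|m].
  by have := truncn_gt0 (beta * n.+1%:R); rewrite EM M1.
have mbe : m.+1%:R <= beta * n.+1%:R < m.+2%:R.
  by rewrite -EM truncn_le truncnS_gt mulr_ge0// ltW.
have hl' : 0 <= lambda < 1 by rewrite l1 ltW.
pose Q k := de < `|n.+1%:R^-1 * k%:R - g|.
have AE : A n.+1 = [set omega | Q (last_passage (fun y => xi y omega) n.+1 m.+1)].
  by rewrite /A EM.
have [mA PA] := last_passage_law Q n m indep geom hl'.
rewrite AE; split => //; rewrite PA.
set N : R := n.+1%:R.
have N0 : 0 < N by rewrite ltr0n.
apply: (@le_trans _ _ (expect (rect n m) (fun=> lambda) (fun w =>
   (((N * (g + de) <= (lpp w n m)%:R)%R%:R : R)%:E +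
    (((lpp w n m)%:R <= N * (g - de))%R%:R : R)%:E)%E) (fun=> 0%N))).
  apply: le_expect => // w _.
  rewrite -EFinD lee_fin /Q.
  have [_|h1] := leP (N * (g + de)) (lpp w n m)%:R.
    by apply: (@le_trans _ _ 1); [case: (_ < _)|rewrite lerDl ler0n].
  have [_|h2] := leP (lpp w n m)%:R (N * (g - de)).
    by apply: (@le_trans _ _ 1); [case: (_ < _)|rewrite lerDr ler0n].
  have h : `|n.+1%:R^-1 * (lpp w n m)%:R - g| <= de.
    rewrite ler_distl ler_pdivlMl// ler_pdivrMl//.
    by rewrite (ltW h1) (ltW h2).
  by rewrite ltNge h /= addr0.
rewrite expectD//.
have /andP[mbe1 _] := mbe.
have U := Hup n m (fun=> 0%N) mbe1; have L := Hlo n m (fun=> 0%N) NN2 mbe.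
rewrite gE in U L.
apply: (le_trans (leeD U L)); rewrite -EFinD lee_fin.
apply: le_trans (H3 _ NN3); rewrite -/N.
have e1 : expR (- (c1 * N)) <= expR (- (c * N)).
  by rewrite ler_expR lerN2 ler_pM2r// ge_min lexx.
have e2 : expR (- (c2 * N)) <= expR (- (c * N)).
  by rewrite ler_expR lerN2 ler_pM2r// ge_min lexx orbT.
apply: (@le_trans _ _ (2 * expR (- (c * N)))); first by move: e1 e2; clear; lra.
rewrite -mulrA ler_pM2l// ler_peMl ?expR_ge0//.
by rewrite /N ler1n.
Qed.

Theorem theorem2p3 (R : realType) (d : measure_display) (T : measurableType d)
    (P : probability T R) (lambda beta : R)
    (hlambda : 0 < lambda < 1) (hbeta : 0 < beta)
    (xi : nat * nat -> {RV P >-> nat})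
    (xi_indep : mutually_independent P quadrant xi)
    (xi_geom : forall y, quadrant y -> geometric_law P lambda (xi y)) :
  let G := fun (N : nat) (omega : T) =>
    last_passage (fun y => xi y omega) N (Num.truncn (beta * N%:R)) in
  {ae P, forall omega : T,
    (N%:R^-1 * (G N omega)%:R : R) @[N --> \oo]
      --> ((1 + Num.sqrt (beta * lambda)) ^+ 2 / (1 - lambda) - 1 : R)} /\
  (forall delta : R, 0 < delta ->
    exists (c : R) (N0 : nat), 0 < c /\
      forall N : nat, (0 < N)%N -> (N0 <= N)%N ->
        (P [set omega : T |
              (delta < `| N%:R^-1 * (G N omega)%:R
                - ((1 + Num.sqrt (beta * lambda)) ^+ 2 / (1 - lambda) - 1) |)%R]
         <= (expR (- (c * N%:R)))%:E)%E).
Proof.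
move=> G.
have dev de (de0 : 0 < de) :=
  last_passage_deviation hlambda hbeta xi_indep xi_geom de0.
split.
  apply: (@ae_cvg_exp_tail _ _ _ _ (fun N w => N%:R^-1 * (G N w)%:R)) => de de0.
  exact: dev.
move=> de de0; have [c [N0 [c0 H]]] := dev _ de0.
by exists c, N0; split => // N _ /H[].
Qed.
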